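(* Let $q$ be a prime power, let $n \geq 20$ be an integer and let $S \subset \mathbb{F}_q^n$. Let $\tau > 1$ be a real number and $\delta \in (0, 1/10)$ such that $$q \geq \max\left(\frac{n(1+\tau)}{(\tau - \sqrt{\tau})^2\delta^2},\, n\right).$$ Suppose $q^r < |S| \leq q^{r+1}$ for some integer $4 \leq r \leq n-1$, and let $t = r-3$. Then at least a $(1-\delta)$-fraction of all surjective linear maps $L : \mathbb{F}_q^n \to \mathbb{F}_q^t$ are such that $L(U_S)$ is $\tau/q^t$-close to the uniform distribution in the $\ell_\infty$ norm, i.e. $|\Pr[L(U_S)=y] - q^{-t}| \leq \tau q^{-t}$ for all $y \in \mathbb{F}_q^t$.
   Context: $U_S$ denotes a random variable distributed uniformly on the finite set $S$. A random variable $X$ on a finite set $Y$ is $\epsilon$-close to uniform in the $\ell_\infty$ norm if $|\Pr[X=y] - 1/|Y|| \leq \epsilon$ for every $y \in Y$. *)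

(* Defs.v *)
From HB Require Import structures.
From mathcomp Require Import all_boot all_order all_algebra.
From mathcomp Require Import reals.
Set Implicit Arguments. Unset Strict Implicit. Unset Printing Implicit Defensive.
Import Order.TTheory GRing.Theory Num.Theory.
Local Open Scope ring_scope.

(* A linear map L : F^n -> F^t is represented by a matrix M : 'M_(n,t),
   acting on row vectors: L(x) = x *m M.  L is surjective iff row_full M. *)

Definition prob_img (R : realType) (F : finFieldType) (n t : nat)
  (S : {set 'rV[F]_n}) (M : 'M[F]_(n, t)) (y : 'rV[F]_t) : R :=
  #|[set x in S | x *m M == y]|%:R / #|S|%:R.

Definition close_to_uniform (R : realType) (F : finFieldType) (n t : nat)
  (S : {set 'rV[F]_n}) (M : 'M[F]_(n, t)) (eps : R) : bool :=
  [forall y : 'rV[F]_t,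
    `| prob_img R S M y - 1 / #|{: 'rV[F]_t}|%:R | <= eps].

Arguments prob_img R {F n t} S M y.
Arguments close_to_uniform R {F n t} S M eps.

(* Main.v *)
(* Since tau > 1, only the upper bound on Pr[L(U_S) = y] can fail.  Write m = t + 2
   and let X be a uniformly random n x m matrix.  By a second moment computation
   the set B(X) of points of F^m that are hit by more than (1 + sqrt tau) times the average
   number of elements of S has expected density at most 1/(q tau).  On the other hand, if
   M is a bad map, y is a fibre of M with too many points and N is a random n x 2 matrix,
   then the same computation inside that fibre shows that B([N | M]) contains all but a
   fraction O(1/n) of the plane { [z | y] }.  Changing coordinates in F^m, every
   2-plane direction is therefore "nearly contained" in B(X) for a proportion
   at least 0.89 delta of the X if a proportion delta of the maps is bad.  A greedy choice
   of about 2.4/delta matrices X gives a union of sets B(X) of total density at most 0.013 that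
   nearly contains a plane in at least half of all directions.  This contradicts
   the Kakeya bound below, which makes that density at least 1/27.

   The Kakeya bound is proved by the method of multiplicities (Dvir, Kopparty, Saraf,
   Sudan; Kopparty, Lev, Saraf, Sudan for planes).  Take P <> 0 of degree d vanishing to high
   order on B.  Restricted to the plane a + x u + y v, its derivatives of order < s vanish
   identically, so the top form of P vanishes to order s at u + w v, where w is
   transcendental over F.  Schwartz-Zippel with multiplicities on the grid
   (F + w F)^m of side q^2 bounds the number of such directions (u, v). *)

Require Import Defs.
From HB Require Import structures.
From mathcomp Require Import all_boot all_order all_algebra.
From mathcomp Require Import reals.
From mathcomp Require Import boolp zify ring lra.
Import Order.TTheory GRing.Theory Num.Theory.
Local Open Scope ring_scope.

Set Implicit Arguments.
Unset Strict Implicit.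
Unset Printing Implicit Defensive.

(** * Iterated polynomials *)

(* Polynomials in m variables as iterated univariate polynomials; the head of a list of
   points or exponents refers to the outermost variable. *)
Fixpoint MP (E : idomainType) (m : nat) : idomainType :=
  if m is k.+1 then {poly MP E k} else E.

Section Ev.
Variables (E : idomainType) (C : comNzRingType) (f : {rmorphism E -> C}).
Fixpoint MPeval m (z : seq C) {struct m} : {rmorphism MP E m -> C} :=
  if m is k.+1 return {rmorphism MP E m -> C}
  then horner_morph (fun x => mulrC (head 0 z) (MPeval k (behead z) x)) else f.

Lemma MPevalS m z (Q : MP E m.+1) :
  MPeval m.+1 z Q = (map_poly (MPeval m (behead z)) Q).[head 0 z].
Proof. by []. Qed.
End Ev.

Fixpoint MPconst (E : idomainType) m : {rmorphism E -> MP E m} :=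
  if m is k.+1 return {rmorphism E -> MP E m} then (polyC \o MPconst E k)%FUN else idfun.
Fixpoint MPvars (E : idomainType) m : seq (MP E m) :=
  if m is k.+1 return seq (MP E m) then 'X :: map polyC (MPvars E k) else [::].
(** Taylor shift [Q(X + a)]: the behaviour of [Q] at [a] is read off the coefficients at the
    origin. *)
Fixpoint MPshift (E : idomainType) m (a : seq E) : {rmorphism MP E m -> MP E m} :=
  if m is k.+1 return {rmorphism MP E m -> MP E m}
  then (comp_poly ('X + (MPconst E k (head 0 a))%:P) \o map_poly (MPshift k (behead a)))%FUN else
    idfun.
Fixpoint MPcoef (E : idomainType) m (al : seq nat) : MP E m -> E :=
  if m is k.+1 return MP E m -> E
  then fun Q => @MPcoef E k (behead al) Q`_(head 0%N al) else id.

Lemma MPeval_ext (E : idomainType) (C : comNzRingType) (f g : {rmorphism E -> C}) m z (Q : MP E m) :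
  f =1 g -> MPeval f m z Q = MPeval g m z Q.
Proof.
move=> fg; elim: m z Q => [|m IH] z Q /=; first exact: fg.
by rewrite /horner_morph; congr (_.[_]); apply: eq_map_poly => x; apply: IH.
Qed.

Lemma rmorph_MPeval (E : idomainType) (C D : comNzRingType) (f : {rmorphism E -> C})
  (g : {rmorphism C -> D}) m z (Q : MP E m) :
  g (MPeval f m z Q) = MPeval (g \o f)%FUN m (map g z) Q.
Proof.
elim: m z Q => [|m IH] z Q //=.
rewrite /horner_morph -horner_map -map_poly_comp.
have -> : head 0 (map g z) = g (head 0 z) by case: z => //=; rewrite rmorph0.
congr (_.[_]); apply: eq_map_poly => x /=; rewrite IH; by case: z.
Qed.

Lemma MPeval_MPvars (E : idomainType) m (Q : MP E m) : MPeval (MPconst E m) m (MPvars E m) Q = Q.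
Proof.
elim: m Q => [|m IH] Q //=; rewrite /horner_morph.
transitivity (Q \Po 'X); last by rewrite comp_polyXr.
congr (_.[_]); apply: eq_map_poly => x.
by rewrite -[in RHS](IH x) (rmorph_MPeval (MPconst E m) polyC).
Qed.

Lemma MPeval_MPconst (E : idomainType) (C : comNzRingType) (f : {rmorphism E -> C}) m (z : seq C)
  c :
  MPeval f m z (MPconst E m c) = f c.
Proof.
elim: m z => [|m IH] z //=; rewrite /horner_morph map_polyC hornerC; exact: IH.
Qed.

Lemma MPeval_MPshift (E : idomainType) (C : comNzRingType) (f : {rmorphism E -> C}) m p (z : seq
  C) (Q : MP E m) :
  size p = m -> size z = m ->
  MPeval f m z (MPshift m p Q) = MPeval f m [seq f x.1 + x.2 | x <- zip p z] Q.
Proof.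
elim: m p z Q => [|m IH] [|b p] [|y z] Q //= [sp] [sz].
rewrite /horner_morph map_comp_poly horner_comp -map_poly_comp.
rewrite rmorphD /= map_polyX map_polyC /= !hornerE MPeval_MPconst addrC.
congr (_.[_]); apply: eq_map_poly => x /=; exact: IH.
Qed.
Lemma MPcoef_add (E : idomainType) m al : {morph @MPcoef E m al : x y / x + y}.
Proof. by elim: m al => [|m IH] al x y //=; rewrite coefD IH. Qed.

Lemma MPcoef0 (E : idomainType) m al : @MPcoef E m al 0 = 0.
Proof. by elim: m al => [|m IH] al //=; rewrite coef0 IH. Qed.

Lemma MPcoef_sum (E : idomainType) m al I r (P : pred I) F :
  @MPcoef E m al (\sum_(i <- r | P i) F i) = \sum_(i <- r | P i) MPcoef al (F i).
Proof. exact: (big_morph _ (@MPcoef_add E m al) (@MPcoef0 E m al)). Qed.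

Lemma MPcoef_constM (E : idomainType) m al c (x : MP E m) :
  MPcoef al (MPconst E m c * x) = c * MPcoef al x.
Proof. by elim: m al x => [|m IH] al x //=; rewrite coefCM IH. Qed.

Lemma MPcoef_neq0 (E : idomainType) m (Q : MP E m) : Q != 0 ->
  exists2 al, size al = m & MPcoef al Q != 0.
Proof.
elim: m Q => [|m IH] Q Q0; first by exists [::].
have : lead_coef Q != 0 by rewrite lead_coef_eq0.
by case/IH => al sal c; exists ((size Q).-1 :: al); rewrite /= ?sal.
Qed.

Lemma MPcoef_MPconst (E : idomainType) m al (c : E) : size al = m ->
  MPcoef al (MPconst E m c) = if sumn al == 0%N then c else 0.
Proof.
elim: m al => [|m IH] [|a al] //= [sal].
by rewrite coefC addn_eq0; case: a => [|a] /=; rewrite ?IH ?MPcoef0.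
Qed.

(** * Filtrations by total degree and by order at the origin *)

(** An arbitrary predicate on degrees, rather than a bound, survives the recursion on [m]: fixing
    the exponent [j] of the outer variable turns [P] into [fun s => P (j + s)]. *)
Definition degvanish (E : idomainType) m (P : pred nat) (Q : MP E m) :=
  forall al, size al = m -> P (sumn al) -> MPcoef al Q = 0.

Lemma degvanishS (E : idomainType) m P (Q : MP E m.+1) :
  degvanish P Q <-> forall j, degvanish (fun s => P (j + s)%N) Q`_j.
Proof.
split=> [H j al sal Pj|H [//|j al] /= [sal] Pj].
  by have := H (j :: al); rewrite /= sal; apply.
exact: H.
Qed.

Lemma degvanish0 (E : idomainType) m P : degvanish P (0 : MP E m).
Proof. by move=> al _ _; rewrite MPcoef0. Qed.

Lemma degvanishD (E : idomainType) m P (x y : MP E m) : degvanish P x -> degvanish P y ->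
  degvanish P (x + y).
Proof. by move=> hx hy al sal Pa; rewrite MPcoef_add hx ?hy ?addr0. Qed.

Lemma degvanish_sum (E : idomainType) m P I r (B : pred I) (F : I -> MP E m) :
  (forall i, B i -> degvanish P (F i)) -> degvanish P (\sum_(i <- r | B i) F i).
Proof.
by move=> H al sal Pa; rewrite MPcoef_sum big1 // => i Bi; apply: H.
Qed.

Lemma degvanish_mul (E : idomainType) m (P1 P2 P : pred nat) (x y : MP E m) :
  (forall a b, P (a + b)%N -> P1 a || P2 b) ->
  degvanish P1 x -> degvanish P2 y -> degvanish P (x * y).
Proof.
elim: m P1 P2 P x y => [|m IH] P1 P2 P x y H hx hy.
  move=> [|//] _ /= P0; case/orP: (H 0 0 P0)%N => h.
    by rewrite (hx [::] erefl h : x = 0) mul0r.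
  by rewrite (hy [::] erefl h : y = 0) mulr0.
apply/degvanishS => j; rewrite coefM; apply: degvanish_sum => i _.
move/degvanishS: hx => hx; move/degvanishS: hy => hy.
apply: IH (hx i) (hy (j - i)%N) => a b Pab; apply: H.
by rewrite addnACA subnKC // -ltnS.
Qed.

Lemma degvanish_constM (E : idomainType) m P c (x : MP E m) : degvanish P x -> degvanish P
  (MPconst E m c * x).
Proof. by move=> h al sal Pa; rewrite MPcoef_constM h ?mulr0. Qed.

(* One proof serves both filtrations: [up] selects upper bounds on the degree,
   otherwise lower bounds on the order of vanishing. *)
Definition ltud (up : bool) (a b : nat) := if up then (b < a)%N else (a < b)%N.
Definition monop (up : bool) (P : pred nat) :=
  forall a b, (if up then a <= b else b <= a)%N -> P a -> P b.

Lemma degvanish_exp (E : idomainType) m up (x : MP E m) j :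
  degvanish (ltud up ^~ 1%N) x -> degvanish (ltud up ^~ j) (x ^+ j).
Proof.
move=> hx; elim: j => [|j IH].
  move=> al sal; rewrite expr0 -(rmorph1 (MPconst E m)) MPcoef_MPconst //.
  by case: up {hx} => /=; rewrite /ltud //; case: (sumn al).
rewrite exprS; apply: degvanish_mul hx IH => a b.
by rewrite /ltud; case: up => ?; apply/orP; lia.
Qed.

(** Substituting polynomials of degree at most 1 (case [up]) cannot raise the degree; substituting
    polynomials without constant term (the other case) cannot lower the order. The first hypothesis
    says that [g] takes constant values. *)
Lemma degvanish_MPeval (E L : idomainType) k (g : {rmorphism E -> MP L k}) up m z (P : pred nat)
  (Q : MP E m) :
  (forall e al, size al = k -> (0 < sumn al)%N -> MPcoef al (g e) = 0) ->
  (forall x, x \in z -> degvanish (ltud up ^~ 1%N) x) ->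
  monop up P -> degvanish P Q -> degvanish P (MPeval g m z Q).
Proof.
move=> hg; elim: m z P Q => [|m IH] z P Q hz hP hQ.
  move=> al sal Pal /=; case: (posnP (sumn al)) => [s0|]; last exact: hg.
  by rewrite s0 in Pal; rewrite (hQ [::] erefl Pal : Q = 0) rmorph0 MPcoef0.
rewrite MPevalS (@horner_coef_wide _ (size Q)) ?size_poly //.
apply: degvanish_sum => i _; rewrite coef_map.
have hz0 : degvanish (ltud up ^~ 1%N) (head 0 z).
  by case: z hz => [|y z] hz; [exact: degvanish0 | apply: hz; rewrite inE eqxx].
have hQi : degvanish (fun s => P (i + s)%N) (MPeval g m (behead z) Q`_i).
  apply: IH; last by move/degvanishS: hQ.
  - by move=> x xz; apply: hz; case: z xz {hz0} => //= y z xz; rewrite inE xz orbT.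
  - by move=> a b ab; apply: hP; case: (up) ab => ?; rewrite leq_add2l.
apply: degvanish_mul hQi (degvanish_exp (j := i) hz0) => a b Pab; rewrite /ltud.
case: (up) hP => hP; case: ltnP => h; rewrite ?orbT // orbF; apply: hP Pab.
  by rewrite addnC leq_add2r.
by rewrite addnC leq_add2l.
Qed.

Definition updeg (E : idomainType) m d (Q : MP E m) := degvanish (fun s => d < s)%N Q.
(** Applied to [MPshift m a Q], this is vanishing of [Q] at [a] with multiplicity at least [M],
    expressed without derivatives. *)
Definition lowdeg (E : idomainType) m M (Q : MP E m) := degvanish (fun s => s < M)%N Q.

Lemma MPshift_neq0 (E : idomainType) m a (Q : MP E m) : size a = m -> Q != 0 -> MPshift m a Q != 0.
Proof.
elim: m a Q => [|m IH] a Q.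
  by move=> _ Q0; exact: Q0.
case: a => [|b a] //= [sa] Q0.
rewrite comp_poly_eq0 ?size_XaddC // -size_poly_eq0.
by rewrite size_map_poly_id0 ?size_poly_eq0 // IH // lead_coef_eq0.
Qed.

(** A monomial of least degree shows that [sumn al] is the exact order at the origin. *)
Lemma exists_order (E : idomainType) m (Q : MP E m) : Q != 0 ->
  exists al, [/\ size al = m, MPcoef al Q != 0 & lowdeg (sumn al) Q].
Proof.
move=> /MPcoef_neq0 [al0 s0 c0].
pose P n := `[< exists al, [/\ size al = m, MPcoef al Q != 0 & sumn al = n] >].
have exP : exists n, P n by exists (sumn al0); apply/asboolP; exists al0.
case: (ex_minnP exP) => n /asboolP [al [sal cal <-]] hmin.
exists al; split=> // be sbe hbe; apply/eqP; apply: contraTT hbe => cbe.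
by rewrite -leqNgt; apply: hmin; apply/asboolP; exists be.
Qed.

(** * Schwartz-Zippel with multiplicities *)

(** [la] will extract a coefficient, which is additive and compatible with scaling by constants but
    not multiplicative. That is enough to commute with a shift of the outer variable. *)
Lemma map_comp_XaddC (A A' : comNzRingType) (la : A -> A') (b : A) (b' : A') (Q : {poly A}) :
  la 0 = 0 -> {morph la : x y / x + y} -> (forall x, la (x * b) = la x * b') ->
  map_poly la (Q \Po ('X + b%:P)) = map_poly la Q \Po ('X + b'%:P).
Proof.
move=> la0 lD lM; pose ma := map_poly la.
have maD : {morph ma : x y / x + y}.
  by move=> x y; apply/polyP => i; rewrite coefD !coef_map_id0 // coefD lD.
have maX x : ma (x * 'X) = ma x * 'X.
  by apply/polyP => i; rewrite coefMX !coef_map_id0 // coefMX; case: i.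
have maC c : ma c%:P = (la c)%:P.
  by apply/polyP => i; rewrite coef_map_id0 // !coefC; case: i.
have maM x : ma (x * b%:P) = ma x * b'%:P.
  by apply/polyP => i; rewrite coefMC !coef_map_id0 // coefMC lM.
rewrite -!/(ma _); elim/poly_ind: Q => [|Q c IH].
  by rewrite comp_poly0 {2}/ma (_ : map_poly _ 0 = 0) ?comp_poly0 // /ma map_poly0.
rewrite maD maX maC !comp_polyD !comp_polyM !comp_polyX !comp_polyC maD maC mulrDr maD maX maM IH.
by rewrite mulrDr.
Qed.

Lemma map_MPcoef_comp (E : idomainType) m al (Q : MP E m.+1) b :
  map_poly (MPcoef al) (Q \Po ('X + (MPconst E m b)%:P)) =
  map_poly (MPcoef al) Q \Po ('X + b%:P).
Proof.
apply: map_comp_XaddC; [exact: MPcoef0 | exact: MPcoef_add |].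
by move=> x; rewrite mulrC MPcoef_constM mulrC.
Qed.

Lemma sum_mult_roots (E : idomainType) (I : finType) (si : I -> E) (k : I -> nat) (R : {poly E}) :
  injective si -> R != 0 ->
  (forall b, exists R', R = R' * ('X - (si b)%:P) ^+ k b) ->
  (\sum_b k b <= (size R).-1)%N.
Proof.
move=> inj R0 H.
have : \prod_(b : I) ('X - (si b)%:P) ^+ k b %| R.
  rewrite -big_enum /=; elim: (enum I) (enum_uniq I) => [|b s IH] /=.
    by rewrite big_nil dvd1p.
  move=> /andP [bs us]; rewrite big_cons Gauss_dvdp ?IH ?andbT //.
    by case: (H b) => R' ->; apply: dvdp_mull.
  apply: coprimep_expl; rewrite coprimep_sym coprimep_XsubC rootE horner_prod.
  rewrite prodf_seq_neq0; apply/allP => c cs /=; rewrite horner_exp expf_neq0 // hornerXsubC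
    subr_eq0.
  by apply: contraNneq bs => /inj ->.
move=> /(dvdp_leq R0); rewrite size_prod; last by move=> b _; rewrite expf_neq0 // polyXsubC_eq0.
under eq_bigr do rewrite size_exp_XsubC -addn1.
by rewrite big_split /= sum1_card; set c := #|_|; move: (size R) => sR; lia.
Qed.

Lemma dvd_shift (E : idomainType) (R : {poly E}) b k :
  (forall j, (j < k)%N -> (R \Po ('X + b%:P))`_j = 0) ->
  exists R', R = R' * ('X - b%:P) ^+ k.
Proof.
move=> H; exists (drop_poly k (R \Po ('X + b%:P)) \Po ('X - b%:P)).
have <- : 'X^k \Po ('X - b%:P) = ('X - b%:P) ^+ k by rewrite comp_Xn_poly.
rewrite -comp_polyM.
have -> : drop_poly k (R \Po ('X + b%:P)) * 'X^k = R \Po ('X + b%:P).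
  rewrite -[RHS](poly_take_drop k) (_ : take_poly k _ = 0) ?add0r //.
  by apply/polyP => i; rewrite coef_take_poly coef0; case: ifP => // /H.
by rewrite -comp_polyA comp_polyD comp_polyX comp_polyC subrK comp_polyXr.
Qed.

Lemma big_tuple_cons (V : nmodType) (I : finType) m (G : seq I -> V) :
  \sum_(t : m.+1.-tuple I) G t = \sum_(a : m.-tuple I) \sum_(b : I) G (b :: a).
Proof.
rewrite pair_bigA /= (reindex (fun p : m.-tuple I * I => cons_tuple p.2 p.1)) //=.
exists (fun t : m.+1.-tuple I => ([tuple of behead t], thead t)) => [[a b] _|t _] /=.
  by congr pair; apply/val_inj.
by rewrite [RHS]tuple_eta; apply/val_inj.
Qed.

(** Induction on [m]. Over a point [a] of the smaller grid, the order of [Q] at [b :: a] exceeds the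
    order of the leading coefficient [lc] at [a] by at most the multiplicity of [b] as a root of a
    nonzero univariate polynomial of degree [t]. The extra factor [#|I|] on both sides avoids the
    exponent [m - 1]. *)
Lemma schwartz_zippel_mult (E : idomainType) (I : finType) (si : I -> E) m d (Q : MP E m)
  (mu : seq I -> nat) :
  injective si -> Q != 0 -> updeg d Q ->
  (forall a : m.-tuple I, lowdeg (mu a) (MPshift m (map si a) Q)) ->
  (\sum_(a : m.-tuple I) mu a * #|I| <= d * #|I| ^ m)%N.
Proof.
move=> inj; elim: m d Q mu => [|m IH] d Q mu Q0 dQ H.
  rewrite big1 // => a _; case: (posnP (mu a)) => [->//|h].
  by have := H a [::] erefl h; move/eqP; rewrite (negPf Q0).
pose lc := lead_coef Q; pose t := (size Q).-1.
have lc0 : lc != 0 by rewrite lead_coef_eq0.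
have /boolp.choice [al Hal] : forall a : m.-tuple I, exists al,
  [/\ size al = m, MPcoef al (MPshift m (map si a) lc) != 0 &
      lowdeg (sumn al) (MPshift m (map si a) lc)].
  by move=> a; apply: exists_order; apply: MPshift_neq0 => //; rewrite size_map size_tuple.
have td : (t <= d)%N.
  have [be sbe cbe] := MPcoef_neq0 lc0.
  rewrite leqNgt; apply: contra cbe => td.
  have /= := dQ (t :: be); rewrite sbe => /(_ erefl) h.
  by apply/eqP/h; apply: leq_trans td (leq_addr _ _).
have dlc : updeg (d - t) lc.
  by move=> be sbe hbe; apply: (dQ (t :: be)) => /=; rewrite ?sbe // -ltn_subLR.
(* [IH] takes multiplicities on all sequences, so the orders of [lc] are extended by 0 off the
   [m]-tuples. *)
pose ia (a : seq I) := if insub a is Some a' then sumn (al a') else 0%N.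
have iaE (a : m.-tuple I) : ia a = sumn (al a) by rewrite /ia valK.
have hIH : (\sum_(a : m.-tuple I) sumn (al a) * #|I| <= (d - t) * #|I| ^ m)%N.
  under eq_bigr do rewrite -iaE.
  by apply: (IH _ lc) => // a; rewrite iaE; have [] := Hal a.
have step (a : m.-tuple I) : (\sum_b mu (b :: a) <= t + sumn (al a) * #|I|)%N.
  have [sal cal ord] := Hal a.
  (* The coefficient of a least monomial [al a] of [lc] at [a]: its entry at [t] is nonzero, and
     extracting it costs at most [sumn (al a)] of the order in the outer variable. *)
  pose R := map_poly (MPcoef (al a)) (map_poly (MPshift m (map si a)) Q).
  have cR : R`_t != 0 by rewrite /R coef_map_id0 ?MPcoef0 // coef_map.
  have R0 : R != 0 by apply: contraNneq cR => ->; rewrite coef0.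
  have sR : ((size R).-1 <= t)%N.
    have : (size R <= size Q)%N by apply: leq_trans (size_poly _ _) _; exact: size_poly.
    by rewrite /t; lia.
  have h : (\sum_b (mu (b :: a) - sumn (al a)) <= (size R).-1)%N.
    apply: (sum_mult_roots inj R0) => b; apply: dvd_shift => j hj.
    rewrite /R -map_MPcoef_comp coef_map_id0 ?MPcoef0 //.
    have /degvanishS /(_ j) := H [tuple of b :: a]; apply => //=.
    by move: hj; move: (mu _) (sumn _) => x y; lia.
  apply: leq_trans (leq_add (leq_trans h sR) (leqnn _)).
  rewrite mulnC -sum_nat_const -big_split /=; apply: leq_sum => b _.
  by rewrite addnC -leq_subLR.
rewrite -big_distrl /= (@big_tuple_cons nat) expnSr mulnA leq_mul2r.
apply/orP; right.
apply: (@leq_trans (\sum_(a : m.-tuple I) (t + sumn (al a) * #|I|))%N).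
  exact: leq_sum.
rewrite big_split /= sum_nat_const card_tuple.
by apply: leq_trans (leq_add (leqnn _) hIH) _; rewrite mulnC -mulnDl subnKC.
Qed.

(** * Homogeneous parts and leading coefficients along lines *)

Fixpoint MPtop (E : idomainType) m (d : nat) : MP E m -> MP E m :=
  if m is k.+1 return MP E m -> MP E m
  then fun Q => \poly_(j < d.+1) @MPtop E k (d - j) Q`_j
  else fun Q => if d == 0%N then Q else 0.

Lemma MPcoef_MPtop (E : idomainType) m d al (Q : MP E m) : size al = m ->
  MPcoef al (MPtop d Q) = if sumn al == d then MPcoef al Q else 0.
Proof.
elim: m d al Q => [|m IH] d [|j al] Q //=; first by case: d.
move=> [sal]; rewrite coef_poly ltnS; case: leqP => jd; last first.
  by rewrite MPcoef0 gtn_eqF // (leq_trans jd) ?leq_addr.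
by rewrite IH // -(eqn_add2l j) subnKC.
Qed.

Lemma updeg_MPtop (E : idomainType) m d (Q : MP E m) : updeg d (MPtop d Q).
Proof. by move=> al sal dal; rewrite MPcoef_MPtop // gtn_eqF. Qed.

Lemma exact_degree (E : idomainType) m d (Q : MP E m) : Q != 0 -> updeg d Q ->
  exists d', [/\ (d' <= d)%N, updeg d' Q & MPtop d' Q != 0].
Proof.
move=> Q0; elim: d => [|d IH] dQ.
  exists 0%N; split=> //; have [al sal cal] := MPcoef_neq0 Q0.
  apply: contraNneq cal => h; case: (posnP (sumn al)) => [s0|/dQ -> //].
  by have := MPcoef_MPtop 0 Q sal; rewrite h s0 MPcoef0 eqxx => <-.
have [h|h] := eqVneq (MPtop d.+1 Q) 0; last by exists d.+1.
case: IH => [al sal|d' [h1 h2 h3]]; last by exists d'; rewrite (leq_trans h1).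
rewrite leq_eqVlt => /orP [/eqP e|/dQ -> //].
by have := MPcoef_MPtop d.+1 Q sal; rewrite h e eqxx MPcoef0 => <-.
Qed.

Lemma coefM_top (L : nzRingType) (a b : {poly L}) i j :
  (size a <= i.+1)%N -> (size b <= j.+1)%N ->
  (size (a * b)%R <= (i + j).+1)%N /\ (a * b)`_(i + j) = a`_i * b`_j.
Proof.
move=> sa sb; split.
  by apply: leq_trans (size_polyMleq _ _) _; lia.
rewrite coefM (bigD1 (inord i)) //= inordK ?ltnS ?leq_addr // addKn big1 ?addr0 // => k.
rewrite -val_eqE /= inordK ?ltnS ?leq_addr // => ki.
case: (ltngtP k i) => [ltk|gtk|e]; last by rewrite e eqxx in ki.
  by rewrite [b`__]nth_default ?mulr0 //; apply: leq_trans sb _; lia.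
by rewrite [a`__]nth_default ?mul0r //; apply: leq_trans sa _.
Qed.

(** Along the line [p + y T], only monomials of degree [d] reach [T^d], and only through the [y]
    part of each of their factors. *)
Lemma MPeval_top (E L : idomainType) (g : {rmorphism E -> L}) m d p y (Q : MP E m) :
  size p = m -> size y = m -> updeg d Q ->
  let z := [seq x.1%:P + x.2%:P * 'X | x <- zip p y] in
  (size (MPeval (polyC \o g)%FUN m z Q) <= d.+1)%N /\
  (MPeval (polyC \o g)%FUN m z Q)`_d = MPeval g m y (MPtop d Q).
Proof.
elim: m d p y Q => [|m IH] d p y Q.
  move=> _ _ _ z /=; split; first by apply: leq_trans (size_polyC_leq1 _) _.
  by rewrite coefC; case: eqP => //; rewrite rmorph0.
case: p => [|p0 p] //; case: y => [|y0 y] //= [sp] [sy] dQ.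
rewrite /horner_morph.
have /degvanishS dQi := dQ.
have sQ : (size Q <= d.+1)%N.
  apply/leq_sizeP => j dj; apply/eqP; apply: contraT => /MPcoef_neq0 [al sal].
  by rewrite (dQi j) ?eqxx // (leq_trans dj) ?leq_addr.
rewrite !(@horner_coef_wide _ d.+1) ?size_poly //; last first.
- by apply: leq_trans (size_poly _ _) sQ.
- by apply: leq_trans (size_poly _ _) _; apply: size_poly.
set z0 := p0%:P + _.
have z0P j : (size (z0 ^+ j) <= j.+1)%N /\ (z0 ^+ j)`_j = y0 ^+ j.
  elim: j => [|j [IH1 IH2]]; first by rewrite !expr0 size_poly1 coef1.
  have sz : (size z0 <= 2)%N.
    by rewrite /z0 addrC -[p0%:P]opprK -polyCN; apply: leq_trans (size_polyD _ _) _;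
      rewrite geq_max size_polyN ?(leq_trans (size_polyC_leq1 _)) // (leq_trans (size_polyMleq _
        _)) // size_polyX; have := size_polyC_leq1 y0; lia.
  have := coefM_top sz IH1; rewrite add1n -exprS IH2 => -[-> ->]; split=> //.
  by rewrite /z0 coefD coefC coefMX coefC /= add0r exprS.
have tP (i : 'I_d.+1) : let t := MPeval (polyC \o g)%FUN m [seq x.1%:P + x.2%:P * 'X | x <- zip p
  y] Q`_i * z0 ^+ i in
   (size t <= d.+1)%N /\ t`_d = MPeval g m y (MPtop (d - i) Q`_i) * y0 ^+ i.
  have [|||h1 h2] := IH (d - i)%N p y Q`_i => //.
    by move=> al sal hal; apply: dQi => //; have := ltn_ord i; move: hal; lia.
  have [h3 h4] := z0P i.
  by have := coefM_top h1 h3; rewrite h2 h4 subnK // -ltnS.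
split.
  apply: leq_trans (size_sum _ _ _) _; apply/bigmax_leqP => i _.
  by rewrite coef_map; case: (tP i).
rewrite coef_sum; apply: eq_bigr => i _.
by rewrite !coef_map coef_poly ltn_ord; case: (tP i).
Qed.

Lemma MPshift_MPconst (E : idomainType) m p (x : E) : MPshift m p (MPconst E m x) = MPconst E m x.
Proof.
elim: m p => [|m IH] p //=; rewrite map_polyC comp_polyC; congr (_%:P); exact: IH.
Qed.

(** * Interpolation with multiplicities *)

Fixpoint MPmonom (E : idomainType) m (al : seq nat) : MP E m :=
  if m is k.+1 then (MPmonom E k (behead al))%:P * 'X^(head 0%N al) else 1.

Lemma MPcoef_MPmonom (E : idomainType) m al be : size al = m -> size be = m ->
  MPcoef be (MPmonom E m al) = (al == be)%:R.
Proof.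
elim: m al be => [|m IH] [|a al] [|b be] //= [sal] [sbe].
rewrite coefCM coefXn eqseq_cons [b == a]eq_sym; case: eqP => _ /=.
  by rewrite mulr1 IH.
by rewrite mulr0 MPcoef0.
Qed.

Definition expos m d := [set t : m.-tuple 'I_d.+1 | (\sum_(i <- t) i <= d)%N].

Lemma exposP m d al : size al = m -> (sumn al <= d)%N ->
  exists2 t, t \in expos m d & al = [seq val i | i <- t].
Proof.
move=> sal hal; pose t : seq 'I_d.+1 := [seq inord a | a <- al].
have st : size t == m by rewrite size_map sal.
have e : al = [seq val i | i <- t].
  rewrite /t -map_comp -[LHS]map_id; apply/eq_in_map => a aal /=.
  rewrite inordK // ltnS (leq_trans _ hal) // sumnE.
  by rewrite (perm_big _ (perm_to_rem aal)) /= big_cons leq_addr.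
exists (Tuple st) => //; rewrite inE /= -(big_map val xpredT id) -e.
by rewrite -sumnE.
Qed.

(** Dimension count: order [l.+1] at one point amounts to ['C(m + l, m)] linear conditions on the
    ['C(m + d, m)] coefficients. *)
Lemma exists_vanishing (E : fieldType) (T : finType) (pt : T -> seq E) m d l :
  (#|T| * 'C(m + l, m) < 'C(m + d, m))%N ->
  exists Q : MP E m, [/\ Q != 0, updeg d Q & forall t, lowdeg l.+1 (MPshift m (pt t) Q)].
Proof.
move=> H.
pose A := expos m d; pose K := [set p : T * m.-tuple 'I_l.+1 | p.2 \in expos m l].
have cA : #|A| = 'C(m + d, m) by rewrite card_partial_ord_partitions.
have cK : #|K| = (#|T| * 'C(m + l, m))%N.
  rewrite -card_partial_ord_partitions -cardsT -cardsX; apply: eq_card => p.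
  by rewrite !inE.
pose al (i : 'I_#|A|) := [seq val x | x <- enum_val i].
pose be (j : 'I_#|K|) := [seq val x | x <- (enum_val j).2].
(* Rows are indexed by monomials and columns by conditions, so a vector of the left kernel lists the
   coefficients of [Q]. *)
pose Mx : 'M[E]_(#|A|, #|K|) :=
  \matrix_(i, j) MPcoef (be j) (MPshift m (pt (enum_val j).1) (MPmonom E m (al i))).
have sal i : size (al i) = m by rewrite size_map size_tuple.
have ker0 : kermx Mx != 0.
  rewrite -mxrank_eq0 mxrank_ker -lt0n subn_gt0.
  by apply: leq_ltn_trans (rank_leq_col _) _; rewrite cA cK.
have [i0 ci0] : exists i0, row i0 (kermx Mx) != 0.
  apply/existsP; apply: contraNT ker0; rewrite negb_exists => /forallP h.
  by apply/eqP/row_matrixP => i; rewrite row0; apply/eqP; have := h i; rewrite negbK.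
pose c := row i0 (kermx Mx).
have cM : c *m Mx = 0 by rewrite /c -row_mul mulmx_ker row0.
pose Q : MP E m := \sum_i MPconst E m (c 0 i) * MPmonom E m (al i).
have cQ b : size b = m -> MPcoef b Q = \sum_i c 0 i * (al i == b)%:R.
  by move=> sb; rewrite MPcoef_sum; apply: eq_bigr => i _; rewrite MPcoef_constM MPcoef_MPmonom.
exists Q; split.
- have /rV0Pn [i ci] := ci0.
  apply/eqP => Q0; have := cQ (al i) (sal i).
  rewrite Q0 MPcoef0 (bigD1 i) //= eqxx mulr1 big1 ?addr0.
    by move/esym/eqP; apply/negP.
  move=> j ji; suff /negPf -> : al j != al i by rewrite mulr0.
  by apply: contraNneq ji => /(inj_map val_inj) /val_inj /enum_val_inj ->.
- move=> b sb hb; rewrite cQ // big1 // => i _; suff /negPf -> : al i != b by rewrite mulr0.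
  apply: contraTneq hb => <-; rewrite -leqNgt.
  have := enum_valP i; rewrite inE; apply: leq_trans.
  by rewrite sumnE big_map.
move=> t b sb hb.
have [t' ht' eb] := exposP sb (hb : (sumn b <= l)%N).
have tK : (t, t') \in K by rewrite inE.
have := congr1 (fun x : 'rV_#|K| => x 0 (enum_rank_in tK (t, t'))) cM.
rewrite !mxE => h; rewrite -[RHS]h rmorph_sum MPcoef_sum; apply: eq_bigr => i _.
rewrite !mxE /be enum_rankK_in //= -eb rmorphM.
by rewrite MPshift_MPconst MPcoef_constM.
Qed.

(** Schwartz-Zippel with multiplicity [M] on the image of [A] and 0 elsewhere. *)
Lemma sz_count (E : idomainType) (I T : finType) (si : I -> E) m d (Q : MP E m) M
  (A : {set T}) (h : T -> m.-tuple I) :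
  injective si -> injective h -> Q != 0 -> updeg d Q ->
  (forall t, t \in A -> lowdeg M (MPshift m (map si (h t)) Q)) ->
  (#|A| * M * #|I| <= d * #|I| ^ m)%N.
Proof.
move=> injs injh Q0 dQ H.
pose mu (a : seq I) := if a \in [seq val (h t) | t in A] then M else 0%N.
have := @schwartz_zippel_mult E I si m d Q mu injs Q0 dQ.
rewrite -big_distrl /= => h1; apply: leq_trans (h1 _); last first.
  move=> a; rewrite /mu; case: ifP => [/imageP [t tA /val_inj ->]|_]; first exact: H.
  by move=> al _.
rewrite leq_mul2r; apply/orP; right.
rewrite -(card_imset (mem A) injh) -sum_nat_const big_mkcond /=.
apply: leq_sum => a _; case: ifP => // /imsetP [t tA ->].
by rewrite /mu ifT //; apply/imageP; exists t.
Qed.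

Lemma lowdeg_MPvars (E : idomainType) m i : lowdeg 1 (nth 0 (MPvars E m) i).
Proof.
elim: m i => [|m IH] [|i] /=; try exact: degvanish0.
  by move=> [|[|j] al] //= [sal] h; rewrite coefX //= MPcoef0.
case: (ltnP i (size (MPvars E m))) => hi; last first.
  by rewrite nth_default ?size_map //; exact: degvanish0.
rewrite (nth_map 0) // => -[|j al] //= [sal] h; rewrite coefC.
by case: j h => [|//] h; apply: IH.
Qed.

(* Let W(Z, x, y) = P(a + x (u + Z) + y v).  For |be| < s the coefficient of Z^be is a
   polynomial in (x, y) of degree at most d that vanishes to order l - |be| on G, hence it
   is zero by Schwartz-Zippel.  The coefficient of T^d in W(Z, T, om T) is the top form of P
   at u + om v + Z. *)
Section PlaneStep.
Variables (F : finFieldType) (E : fieldType) (io : {rmorphism F -> E}) (om : E).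
Variables (m d l s : nat) (P : MP E m) (a u v : seq E) (G : {set F * F}).
Hypotheses (sa : size a = m) (su : size u = m) (sv : size v = m).
Hypothesis dP : updeg d P.
Definition plane_pt (p : F * F) := [seq nth 0 a i + io p.1 * nth 0 u i + io p.2 * nth 0 v i | i
  <- iota 0 m].
Hypothesis GP : forall p, p \in G -> lowdeg l (MPshift m (plane_pt p) P).
Hypothesis sl : (s <= l)%N.
Hypothesis num : (d * #|F| < (l - s).+1 * #|G|)%N.

(** [MP L 2] is convertible to [MP E m.+2]: [W] is a polynomial in [x, y] over [E[Z]] when its
    degree is bounded, and a polynomial in [m + 2] variables when its order on [G] is. *)
Let L : idomainType := MP E m.
Let cL : {rmorphism E -> L} := MPconst E m.
Let g0 : {rmorphism E -> MP L 2} := (MPconst L 2 \o cL)%FUN.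
Let Z := MPvars E m.
Let X0 : MP L 2 := 'X.
Let X1 : MP L 2 := ('X)%:P.
Let zz (i : nat) : MP L 2 := g0 (nth 0 a i) + X0 * MPconst L 2 (cL (nth 0 u i) + nth 0 Z i)
  + X1 * MPconst L 2 (cL (nth 0 v i)).
Let z := [seq zz i | i <- iota 0 m].
Let W : MP L 2 := MPeval g0 m z P.

Let size_Z : size Z = m.
Proof. by rewrite /Z; elim: m => [|k IH] //=; rewrite size_map IH. Qed.

Let updegW : updeg d W.
Proof.
apply: (@degvanish_MPeval E L 2 g0 true) dP => [e al sal h|x|x y /= xy]; last by move/leq_trans;
  apply.
  by rewrite MPcoef_MPconst // gtn_eqF.
case/mapP => i _ ->.
have wc c : degvanish (fun s => 0 < s)%N (MPconst L 2 c) by move=> al sal h; rewrite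
  MPcoef_MPconst // gtn_eqF.
have wcX (x0 : MP L 2) c : degvanish (ltud true ^~ 1%N) x0 -> degvanish (ltud true ^~ 1%N) (x0 *
  MPconst L 2 c).
  by move=> wx; apply: degvanish_mul wx (wc c) => j k; rewrite /ltud; lia.
apply: degvanishD; first apply: degvanishD.
- by move=> al sal h; apply: wc => //; apply: leq_trans h.
- by apply: wcX => -[|[|[|j]] [|k []]] //= _ h; rewrite ?coefX ?coefC ?coef0 //; case: k h.
- apply: wcX => -[|[|j] [|[|[|k]] []]] //= _ h; rewrite ?coefC ?coefX ?coef0 //.
Qed.

(** Moving the origin of the plane to [p] turns the argument of [P] into [plane_pt p] plus
    [x (u + Z) + y v + p.1 Z], which has no constant term. *)
Let lowdeg_W p : p \in G -> lowdeg l (MPshift 2 [:: cL (io p.1); cL (io p.2)] W : MP E m.+2).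
Proof.
move=> pG.
have -> : MPshift 2 [:: cL (io p.1); cL (io p.2)] W =
  MPeval (MPconst E m.+2) m [seq MPconst E m.+2 x.1 + x.2 | x <- zip (plane_pt p)
    [seq X0 * MPconst L 2 (cL (nth 0 u i) + nth 0 Z i) + X1 * MPconst L 2 (cL (nth 0 v i)) +
      MPconst L 2 (cL (io p.1) * nth 0 Z i) | i <- iota 0 m]] P.
  rewrite rmorph_MPeval.
  have -> : [seq MPshift 2 [:: cL (io p.1); cL (io p.2)] x | x <- z] = 
    [seq MPconst E m.+2 x.1 + x.2 | x <- zip (plane_pt p)
    [seq X0 * MPconst L 2 (cL (nth 0 u i) + nth 0 Z i) + X1 * MPconst L 2 (cL (nth 0 v i)) +
      MPconst L 2 (cL (io p.1) * nth 0 Z i) | i <- iota 0 m]].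
    rewrite /z /plane_pt zip_map -!map_comp; apply/eq_in_map => i _.
    rewrite -[LHS]/(MPshift 2 [:: cL (io p.1); cL (io p.2)] (zz i)).
    have hX0 : MPshift 2 [:: cL (io p.1); cL (io p.2)] X0 = X0 + MPconst L 2 (cL (io p.1)).
      by rewrite /X0 /= map_polyX comp_polyX.
    have hX1 : MPshift 2 [:: cL (io p.1); cL (io p.2)] X1 = X1 + MPconst L 2 (cL (io p.2)).
      by rewrite /X1 /= map_polyC /= comp_polyC map_polyX comp_polyX rmorphD.
    rewrite /zz (rmorphD (MPshift 2 _)) (rmorphD (MPshift 2 _)) (rmorphM (MPshift 2 _)) (rmorphM
      (MPshift 2 _)) hX0 hX1.
    rewrite (MPshift_MPconst (E := L) 2) (MPshift_MPconst (E := L) 2) (MPshift_MPconst (E := L) 2).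
    rewrite -[RHS]/(g0 (nth 0 a i + io p.1 * nth 0 u i + io p.2 * nth 0 v i) +
      (X0 * MPconst L 2 (cL (nth 0 u i) + nth 0 Z i) + X1 * MPconst L 2 (cL (nth 0 v i)) +
        MPconst L 2 (cL (io p.1) * nth 0 Z i))).
    have g0E x : g0 x = MPconst L 2 (cL x) by [].
    rewrite !g0E !(rmorphD cL) !(rmorphM cL) !(rmorphD (MPconst L 2)) !(rmorphM (MPconst L 2)).
    move: (MPconst L 2) => c2; move: X0 X1 => x0 x1.
    by ring.
  apply: MPeval_ext => x; exact: (@MPshift_MPconst L 2 _ (cL x)).
rewrite -MPeval_MPshift ?size_map ?size_iota //.
apply: (@degvanish_MPeval E E m.+2 (MPconst E m.+2) false) (GP pG) => [e al sal h|x|x y /= xy];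
  last by apply: leq_ltn_trans.
  by rewrite MPcoef_MPconst // gtn_eqF.
case/mapP => i _ ->.
have wr (t t' : MP E m.+2) : lowdeg 1 t -> lowdeg 1 (t * t').
  move=> wx; apply: (degvanish_mul (P2 := pred0)) wx _ => [j k|//]; rewrite ?orbF; lia.
have wZ : lowdeg 1 (MPconst L 2 (nth 0 Z i) : MP E m.+2).
  move=> [|j [|k al]] //= [sal] h; rewrite coefC; case: j h => [|//] h; rewrite /= coefC; case: k
    h => [|//] h.
  exact: lowdeg_MPvars.
have hX0 : lowdeg 1 (X0 : MP E m.+2).
  by move=> [|[|j] [|k al]] //= _ h; rewrite /X0 coefX coef0 MPcoef0.
have hX1 : lowdeg 1 (X1 : MP E m.+2).
  move=> [|[|j] [|[|k] al]] //= _ h; by rewrite /X1 coefC coefX MPcoef0.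
apply: degvanishD; first by apply: degvanishD; apply: wr.
by rewrite rmorphM /= mulrC; apply: wr.
Qed.
Let coefW_eq0 be j k : size be = m -> (sumn be < s)%N -> MPcoef be (W`_j`_k) = 0.
Proof.
move=> sbe hbe; pose la := map_poly (@MPcoef E m be).
pose R : MP E 2 := map_poly la W.
have c0 := @MPcoef0 E m be.
have la0 : la 0 = 0 by rewrite /la map_poly0.
have laD : {morph la : x y / x + y}.
  by move=> x y; apply/polyP => i; rewrite coefD !coef_map_id0 // coefD MPcoef_add.
have coefR j' k' : R`_j'`_k' = MPcoef be (W`_j'`_k') by rewrite !coef_map_id0.
have shR x y : MPshift 2 [:: x; y] R = map_poly la (MPshift 2 [:: cL x; cL y] W).
  rewrite /= (@map_comp_XaddC _ _ la _ (x%:P)) //; last first.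
    move=> w; apply/polyP => i; rewrite coefMC !coef_map_id0 // coefMC.
    by rewrite mulrC MPcoef_constM mulrC.
  congr (_ \Po _); rewrite /R -!map_poly_comp_id0 //; last by rewrite rmorph0.
  apply: eq_map_poly => w /=.
  rewrite !map_poly_id //.
  rewrite /la (@map_comp_XaddC _ _ (MPcoef be) _ y) //; first exact: MPcoef_add.
  by move=> x'; rewrite mulrC MPcoef_constM mulrC.
have [R0|R0] := eqVneq R 0; first by rewrite -coefR R0 !coef0.
have dR : updeg d R.
  by move=> [|j' [|k' []]] // _ h; have /= hW := updegW (al := [:: j'; k']) erefl h; rewrite /=
    coefR hW MPcoef0.
pose h (p : F * F) : 2.-tuple F := [tuple p.1; p.2].
have injh : injective h by move=> [x y] [x' y'] [-> ->].
have := sz_count (M := l - sumn be) (A := G) (fmorph_inj io) injh R0 dR.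
move=> hsz; suff : (#|G| * (l - sumn be) * #|F| <= d * #|F| ^ 2)%N.
  rewrite expnS expn1 mulnA leq_pmul2r; last by apply/card_gt0P; exists 0.
  move=> hh; exfalso; move: (leq_ltn_trans hh num); rewrite mulnC ltn_mul2r => /andP [_].
  by move: hbe sl; clear; lia.
apply: hsz => p pG [|j' [|k' []]] // _ hjk.
rewrite [map _ _]/= shR /= !coef_map_id0 //.
apply: (lowdeg_W pG (al := [:: j', k' & be])); first by rewrite /= sbe.
by move: hjk => /=; lia.
Qed.

Lemma plane_step :
  lowdeg s (MPshift m [seq nth 0 u i + om * nth 0 v i | i <- iota 0 m] (MPtop d P)).
Proof.
pose tau := MPeval (polyC : {rmorphism L -> {poly L}}) 2 [:: 'X; (cL om)%:P * 'X].
pose w := [seq nth 0 u i + om * nth 0 v i | i <- iota 0 m].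
pose pp := [seq cL (nth 0 a i) | i <- iota 0 m].
pose y := [seq cL x.1 + x.2 | x <- zip w Z].
have sw : size w = m by rewrite size_map size_iota.
have spp : size pp = m by rewrite size_map size_iota.
have sy : size y = m by rewrite size_map size_zip sw size_Z minnn.
have tW : tau W = MPeval (polyC \o cL)%FUN m [seq x.1%:P + x.2%:P * 'X | x <- zip pp y] P.
  rewrite /W rmorph_MPeval.
  have -> : [seq tau x | x <- z] = [seq x.1%:P + x.2%:P * 'X | x <- zip pp y].
    have eZ : Z = [seq nth 0 Z i | i <- iota 0 m].
      by rewrite -[LHS](mkseq_nth 0) size_Z.
    rewrite /z /pp /y /w eZ zip_map -!map_comp zip_map -!map_comp; apply/eq_in_map => i _.
    rewrite -[LHS]/(tau (zz i)).
    have tc c : tau (MPconst L 2 c) = c%:P.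
      exact: MPeval_MPconst.
    have tX0 : tau X0 = 'X by rewrite /tau MPevalS /X0 map_polyX hornerX.
    have tX1 : tau X1 = (cL om)%:P * 'X.
      rewrite /tau MPevalS /X1 map_polyC hornerC.
      have e1 c : MPeval (polyC : {rmorphism L -> {poly L}}) 1 [:: c] ('X : {poly L}) = c.
        by rewrite MPevalS map_polyX hornerX.
      exact: e1.
    rewrite /zz !(rmorphD tau) !(rmorphM tau) tX0 tX1 !tc.
    rewrite -[RHS]/((cL (nth 0 a i))%:P + (cL (nth 0 u i + om * nth 0 v i) + nth 0 Z i)%:P * 'X).
    rewrite !(rmorphD cL) !(rmorphM cL) !(rmorphD polyC) !(rmorphM polyC).
    by ring.
  apply: MPeval_ext => x; rewrite -[LHS]/(tau (MPconst L 2 (cL x))).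
  exact: MPeval_MPconst.
(* The coefficient of [T^d] is the top form at [w + Z]; since [Z] consists of the variables
   themselves, this is the shifted top form. *)
have [_] := MPeval_top cL spp sy dP; rewrite -tW.
rewrite /y -MPeval_MPshift ?size_Z // MPeval_MPvars -/w => <-.
rewrite /tau MPevalS horner_coef coef_sum; apply: degvanish_sum => j _.
rewrite coefMXn; case: ifP => _; first exact: degvanish0.
rewrite coef_map_id0 ?rmorph0 // MPevalS horner_coef coef_sum; apply: degvanish_sum => k _.
rewrite coef_map /= exprMn -rmorphXn -rmorphXn /= coefCM coefCM mulrCA.
apply: degvanish_constM => be sbe hbe.
rewrite coefXn; case: eqP => _; last by rewrite mulr0 MPcoef0.
by rewrite mulr1; apply: coefW_eq0.
Qed.
End PlaneStep.

(** * The Kakeya bound for planes *)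

(** The first hypothesis provides [P] of degree at most [d] and order [l.+1] on [B]; the third is
    the numerical condition of [plane_step]. [D] consists of ordered pairs of vectors, each pair
    giving its own point of the grid of side [q^2], where the top form has order at least [s]. *)
Theorem kakeya_planes (F : finFieldType) m d l s g (B : {set 'rV[F]_m}) (D : {set 'M[F]_(2, m)}) :
  (#|B| * 'C(m + l, m) < 'C(m + d, m))%N ->
  (s <= l.+1)%N -> (d * #|F| < (l.+1 - s).+1 * g)%N ->
  (forall Q, Q \in D -> exists a, (g <= #|[set z : 'rV[F]_2 | (z *m Q + a)%R \in B]|)%N) ->
  (#|D| * s * #|F| ^ 2 <= d * #|F| ^ (2 * m))%N.
Proof.
move=> hB sl num HD.
pose E : fieldType := {fraction {poly F}}.
pose io : {rmorphism F -> E} := ((@tofrac {poly F}) \o polyC)%FUN.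
pose om : E := tofrac 'X.
(* [1] and [om] are independent over [F], so [(u, v)] can be recovered from [u + om v]. *)
pose si (p : F * F) : E := io p.1 + om * io p.2.
have inj_si : injective si.
  move=> [x y] [x' y'] h.
  have {}h : x%:P + 'X * y%:P = x'%:P + 'X * y'%:P.
    by apply/eqP; rewrite -tofrac_eq !rmorphD !rmorphM; apply/eqP.
  have h0 := congr1 (fun p : {poly F} => p`_0) h.
  have h1 := congr1 (fun p : {poly F} => p`_1) h.
  rewrite !coefD !coefXM !coefC /= !addr0 in h0; rewrite !coefD !coefXM !coefC /= !add0r in h1.
  by rewrite h0 h1.
pose tos (x : 'rV[F]_m) : seq E := [seq io (x 0 i) | i <- enum 'I_m].
have s_tos x : size (tos x) = m by rewrite size_map size_enum_ord.
have n_tos x (i : 'I_m) : nth 0 (tos x) i = io (x 0 i).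
  by rewrite (nth_map i) ?size_enum_ord // nth_ord_enum.
have hB' : (#|'I_#|B| | * 'C(m + l, m) < 'C(m + d, m))%N by rewrite card_ord.
have [P [P0 dP BP]] := exists_vanishing (fun i : 'I_#|B| => tos (enum_val i)) hB'.
(* At the exact degree the top form is nonzero; the numerical conditions only improve when [d] drops
   to [d']. *)
have [d' [d'd d'P top0]] := exact_degree P0 dP.
pose h (Q : 'M[F]_(2, m)) := [tuple (Q 0 i, Q 1 i) | i < m].
have injh : injective h.
  move=> Q Q' e; apply/matrixP => i j.
  have := congr1 (fun t => tnth t j) e; rewrite !tnth_mktuple => -[e0 e1].
  have [->|->] : i = 0 \/ i = 1 by case: i => [[|[|]]] // hi; [left|right]; apply/val_inj.
    exact: e0.
  exact: e1.
have := sz_count (M := s) (A := D) inj_si injh top0 (@updeg_MPtop E m d' P).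
rewrite card_prod mulnn -expnM => hsz; apply: leq_trans (hsz _) _; last by rewrite leq_mul2r d'd
  orbT.
move=> Q QD; have [a ha] := HD Q QD.
have -> : map si (h Q) = [seq nth 0 (tos (row 0 Q)) i + om * nth 0 (tos (row 1 Q)) i | i <- iota
  0 m].
  rewrite -val_enum_ord -!map_comp; apply: eq_map => i /=.
  by rewrite !n_tos !mxE.
pose G := [set p : F * F | (a + p.1 *: row 0 Q + p.2 *: row 1 Q)%R \in B].
have gG : (g <= #|G|)%N.
  apply: leq_trans ha _.
  have injz : injective (fun z : 'rV[F]_2 => (z 0 0, z 0 1)).
    move=> z z' [e0 e1]; apply/rowP => i.
    by have [->|->] : i = 0 \/ i = 1 by case: i => [[|[|]]] // hi; [left|right]; apply/val_inj.
  rewrite -(card_imset _ injz); apply/subset_leq_card/subsetP => p /imsetP [z].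
  rewrite !inE => hz -> /=; congr (_ \in B): hz.
  have e1 : lift ord0 ord0 = 1 :> 'I_2 by apply/val_inj.
  have e0 : ord0 = 0 :> 'I_2 by apply/val_inj.
  by rewrite mulmx_sum_row big_ord_recl big_ord1 e1 e0 addrC addrA.
apply: (@plane_step F E io om m d' l.+1 s P (tos a) (tos (row 0 Q)) (tos (row 1 Q)) G) => //.
  move=> p; rewrite inE => pB.
  have -> : plane_pt io m (tos a) (tos (row 0 Q)) (tos (row 1 Q)) p =
    tos (a + p.1 *: row 0 Q + p.2 *: row 1 Q).
    rewrite /plane_pt -val_enum_ord -map_comp; apply: eq_map => i /=.
    by rewrite !n_tos !mxE !rmorphD !rmorphM.
  by have := BP (enum_rank_in pB (a + p.1 *: row 0 Q + p.2 *: row 1 Q)); rewrite enum_rankK_in.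
apply: leq_ltn_trans (leq_trans num _); first by rewrite leq_mul2r d'd orbT.
by rewrite leq_mul2l gG orbT.
Qed.

(** * Quantitative density of Kakeya sets of planes *)

Lemma bernoulli_nat N k : (N ^ k.+1 + k.+1 * N ^ k <= N.+1 ^ k.+1)%N.
Proof.
elim: k => [|k IH]; first by rewrite !expn1 expn0; lia.
rewrite [(N.+1 ^ k.+2)%N]expnS; apply: leq_trans (leq_mul (leqnn N.+1) IH).
rewrite [(N ^ k.+2)%N]expnS [(N ^ k.+1)%N]expnS; nia.
Qed.

(** The sequence [(1 + 1/n)^(n+1)] decreases, and [n = 5] is the first index where it is below 3.
    The step is Bernoulli at [N = n (n + 2)], as [N + 1 = (n + 1)^2]. *)
Lemma exp_succ_le n : (5 <= n)%N -> (n.+1 ^ n <= 3 * n ^ n)%N.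
Proof.
move=> n5; have h : (n.+1 ^ n.+1 <= 3 * n ^ n.+1)%N.
  elim: n n5 => // n IH; rewrite leq_eqVlt => /orP [/eqP <- //|]; rewrite ltnS => n5.
  have {}IH := IH n5; pose N := (n * n.+2)%N.
  have N0 : (0 < n ^ n.+1)%N by rewrite expn_gt0; lia.
  rewrite -(leq_pmul2l N0).
  have e1 : (n ^ n.+1 * n.+2 ^ n.+2 = N ^ n.+1 * n.+2)%N by rewrite [(n.+2 ^ n.+2)%N]expnSr /N
    expnMn mulnA.
  have e2 : (n.+1 ^ n.+1 * n.+1 ^ n.+2 = N.+1 ^ n.+1 * n.+1)%N.
    have -> : N.+1 = (n.+1 * n.+1)%N by rewrite /N; lia.
    by rewrite [(n.+1 ^ n.+2)%N]expnSr expnMn mulnA.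
  rewrite e1; apply: (@leq_trans (n.+1 ^ n.+1 * n.+1 ^ n.+2)).
    rewrite e2; apply: leq_trans (leq_mul (bernoulli_nat N n) (leqnn _)).
    have : (N <= n.+1 * n.+1)%N by rewrite /N; lia.
    rewrite expnS; move: (N ^ n)%N => x hN; clear e1 e2; move: N hN => y; nia.
  by rewrite mulnA leq_mul2r [(_ * 3)%N]mulnC IH orbT.
rewrite -(@leq_pmul2l n.+1) // -expnS; apply: leq_trans h _.
rewrite expnS; nia.
Qed.

(** From [1 + 3/n <= (1 + 1/n)^3] and the bound 3 above, whence [27 = 3^3]. *)
Lemma exp_add3_le n m : (5 <= n)%N -> (m <= n)%N -> ((n + 3) ^ m <= 27 * n ^ m)%N.
Proof.
move=> n5 mn; have n0 : (0 < n)%N by lia.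
have h : ((n + 3) ^ n <= 27 * n ^ n)%N.
  have h3 : ((n + 3) * (n * n) <= n.+1 ^ 3)%N by rewrite !expnS expn0; nia.
  rewrite -(@leq_pmul2r ((n * n) ^ n)) ?expn_gt0 ?muln_gt0 ?n0 // -expnMn.
  apply: (@leq_trans ((n.+1 ^ 3) ^ n)); first by rewrite leq_exp2r.
  rewrite -expnM mulnC expnM.
  apply: leq_trans (_ : (3 * n ^ n) ^ 3 <= _)%N; first by rewrite leq_exp2r // exp_succ_le.
  by rewrite expnMn expnMn !expnS expn0; nia.
rewrite -(@leq_pmul2r (n ^ (n - m))) ?expn_gt0 ?n0 // -mulnA -expnD subnKC //.
have e : ((n + 3) ^ n = (n + 3) ^ m * (n + 3) ^ (n - m))%N by rewrite -expnD subnKC.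
apply: leq_trans h; rewrite e leq_mul2l.
by case: (posnP (n - m)) => [->|?]; rewrite ?expn0 ?orbT // leq_exp2r ?leq_addr ?orbT.
Qed.

(** Factor by factor in the falling factorials, [q (m + l - i) / (m + d - i) <= 1 + 3/n]: the terms
    [25 n], [2 q] and [m <= n] cost at most [2.8/n]. *)
Lemma bin_ratio_le n m q l d :
  (5 <= n)%N -> (n <= q)%N -> (m <= n)%N ->
  (l < 25 * n + 10 * n * q + 2 * q)%N -> d = (10 * n * q ^ 2)%N ->
  (q ^ m * 'C(m + l, m) <= 27 * 'C(m + d, m))%N.
Proof.
move=> n5 nq mn hl hd; have n0 : (0 < n)%N by lia.
rewrite -(@leq_pmul2r m`!) ?fact_gt0 // -!mulnA !bin_ffact !ffact_prod.
rewrite -(@leq_pmul2l (n ^ m)) ?expn_gt0 ?n0 //.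
apply: (@leq_trans ((n + 3) ^ m * \prod_(i < m) (m + d - i))%N).
  have cE c : (c ^ m = \prod_(i < m) c)%N by rewrite prod_nat_const card_ord.
  rewrite !cE mulnA -!big_split /=; apply: leq_prod => i _.
  have hi := ltn_ord i.
  apply: (@leq_trans (n * q * (26 * n + 10 * n * q + 2 * q))%N).
    by rewrite leq_mul2l; apply/orP; right; lia.
  apply: (@leq_trans ((n + 3) * d)%N); last by rewrite leq_mul2l; apply/orP; right; lia.
  by rewrite hd; nia.
by rewrite [(n ^ m * _)%N]mulnCA mulnA leq_mul2r exp_add3_le ?orbT.
Qed.

Theorem kakeya_planes_density (F : finFieldType) n m (B : {set 'rV[F]_m}) (D : {set 'M[F]_(2, m)}) :
  (5 <= n)%N -> (n <= #|F|)%N -> (m <= n)%N ->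
  (2 * #|F| ^ (2 * m) < 5 * #|D|)%N ->
  (forall Q, Q \in D -> exists a,
    ((10 * n - 1) * #|F| ^ 2 <= 10 * n * #|[set z : 'rV[F]_2 | (z *m Q + a)%R \in B]|)%N) ->
  (#|F| ^ m <= 27 * #|B|)%N.
Proof.
move=> n5; set q := #|F| => nq mn hD HD; rewrite leqNgt; apply/negP => hB.
have q0 : (0 < q)%N by lia.
(* With [s = 25 n] the conclusion will read [#|D| <= (2/5) q^(2m)]. In [l], the term [25 n] pays for
   [s], and [2 q] outweighs the loss of [q] due to the missing fraction [1/(10 n)] of a plane. [g]
   is the ceiling of [x / (10 n)]. *)
pose l := (25 * n + 10 * n * q + 2 * q).-1; pose d := (10 * n * q ^ 2)%N.
pose x := ((10 * n - 1) * q ^ 2)%N; pose g := (x.-1 %/ (10 * n)).+1.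
have x0 : (0 < x)%N by rewrite /x muln_gt0 expn_gt0 q0 subn_gt0; lia.
have l1 : l.+1 = (25 * n + 10 * n * q + 2 * q)%N by rewrite /l; lia.
have hBl : (#|B| * 'C(m + l, m) < 'C(m + d, m))%N.
  have hb := @bin_ratio_le n m q l d n5 nq mn (eq_leq l1) erefl.
  have c0 : (0 < 'C(m + l, m))%N by rewrite bin_gt0 leq_addr.
  rewrite -(@ltn_pmul2l 27) //; apply: leq_trans hb.
  by rewrite mulnA ltn_pmul2r.
have gx : (x <= 10 * n * g)%N.
  have := ltn_ceil x.-1 (_ : 0 < 10 * n)%N; rewrite /g mulnC; move/(_ ltac:(lia)).
  by move: x0; lia.
have hnum : (d * q < (l.+1 - 25 * n).+1 * g)%N.
  rewrite -(@ltn_pmul2l (10 * n)) ?muln_gt0; last lia.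
  have -> : (l.+1 - 25 * n = 10 * n * q + 2 * q)%N by lia.
  rewrite [(10 * n * (_ * g))%N]mulnCA; apply: leq_trans (leq_mul (leqnn _) gx).
  have [k k1 kE] : exists2 k, (1 < k)%N & (10 * n = k.+1)%N by exists (10 * n).-1; lia.
  rewrite /x /d kE subn1 /=.
  have -> : (k.+1 * (k.+1 * q ^ 2 * q) = k.+1 * (k.+1 * q) * q ^ 2)%N by ring.
  rewrite [ltnRHS]mulnA ltn_pmul2r ?expn_gt0 ?q0 //.
  by move: k1 (q) => k1 q1; clear -k1; nia.
have := @kakeya_planes F m d l (25 * n) g B D hBl; rewrite l1.
move=> /(_ ltac:(lia)); rewrite -l1 => /(_ hnum) hk.
have : (#|D| * (25 * n) * q ^ 2 <= d * q ^ (2 * m))%N.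
  apply: hk => Q QD; have [a ha] := HD Q QD; exists a.
  rewrite -/x in ha; rewrite /g ltn_divLR; last by move: n5; clear; lia.
  by rewrite mulnC; move: ha x0; clear; lia.
have qq : (0 < 5 * n * q ^ 2)%N by rewrite muln_gt0 expn_gt0 q0 /= muln_gt0; lia.
have -> : (#|D| * (25 * n) * q ^ 2 = 5 * n * q ^ 2 * (5 * #|D|))%N by ring.
have -> : (d * q ^ (2 * m) = 5 * n * q ^ 2 * (2 * q ^ (2 * m)))%N by rewrite /d; ring.
by rewrite leq_pmul2l // leqNgt hD.
Qed.

(** * Linear hashing *)

Definition load (F : finFieldType) n b (S : {set 'rV[F]_n}) (M : 'M[F]_(n, b)) (y : 'rV[F]_b) :=
  #|[set x in S | x *m M == y]|.

Lemma sum_fiber (T I : finType) (A : {set T}) (f : T -> I) :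
  (\sum_(y : I) #|[set x in A | f x == y]| = #|A|)%N.
Proof.
rewrite -sum1_card (partition_big f xpredT) //=; apply: eq_bigr => y _.
by rewrite -sum1_card; apply: eq_bigl => x; rewrite inE.
Qed.

(** For nonzero [z] all fibres of [M |-> z M] are translates of one another, so each value has
    probability [q^-b]. *)
Lemma card_annihilator (F : finFieldType) n b (z : 'rV[F]_n) : z != 0 ->
  (#|[set M : 'M[F]_(n, b) | z *m M == 0%R]| * #|F| ^ b = #|F| ^ (n * b))%N.
Proof.
move=> /rV0Pn [i zi].
have fib y : #|[set M in [set: 'M[F]_(n, b)] | z *m M == y]| =
             #|[set M : 'M[F]_(n, b) | z *m M == 0]|.
  pose My : 'M[F]_(n, b) := (z 0 i)^-1 *: (delta_mx i 0 *m y).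
  have zMy : z *m My = y.
    rewrite /My -scalemxAr mulmxA -colE [col _ _]mx11_scalar mxE mul_scalar_mx.
    by rewrite scalerA mulVf // scale1r.
  rewrite -[RHS](card_imset _ (addrI My)); apply: eq_card => M.
  rewrite !inE /=; apply/eqP/imsetP => [h|[M' + ->]].
    by exists (M - My); [rewrite inE mulmxBr h zMy subrr | rewrite addrC subrK].
  by rewrite inE mulmxDr zMy => /eqP ->; rewrite addr0.
have := sum_fiber [set: 'M[F]_(n, b)] (mulmx z).
under eq_bigr do rewrite fib.
by rewrite sum_nat_const cardsT !card_mx mul1n mulnC.
Qed.

(** Union bound over the nonzero [y] killed by [M^T], each event having probability [q^-n]. *)
Lemma card_not_row_full (F : finFieldType) n b :
  (#|[set M : 'M[F]_(n, b) | ~~ row_full M]| * #|F| ^ n <= #|F| ^ b * #|F| ^ (n * b))%N.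
Proof.
pose K (y : 'rV[F]_b) := [set M : 'M[F]_(n, b) | y *m M^T == 0].
have cK y : y != 0 -> (#|K y| * #|F| ^ n = #|F| ^ (n * b))%N.
  move=> y0; rewrite [(n * b)%N]mulnC -(card_annihilator n y0); congr (_ * _)%N.
  rewrite -(card_imset (mem (K y)) (@trmx_inj F n b)); apply: eq_card => M.
  apply/imsetP/idP => [[M' + ->]|]; rewrite !inE // => h.
  by exists M^T; rewrite ?inE trmxK.
apply: (@leq_trans (\sum_(y : 'rV[F]_b | y != 0%R) #|K y| * #|F| ^ n)%N); last first.
  apply: (@leq_trans (\sum_(y : 'rV[F]_b | y != 0%R) #|F| ^ (n * b))%N).
    by apply: leq_sum => y /cK ->.
  rewrite sum_nat_const leq_mul2r; apply/orP; right.
  by apply: leq_trans (max_card _) _; rewrite card_mx mul1n.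
rewrite -big_distrl /= leq_mul2r; apply/orP; right.
apply: (@leq_trans #|\bigcup_(y : 'rV[F]_b | y != 0%R) K y|); last first.
  elim/big_rec2: _ => [|y c U y0 h]; first by rewrite cards0.
  by apply: leq_trans (leq_card_setU _ _) _; rewrite leq_add2l.
apply/subset_leq_card/subsetP => M; rewrite inE => hM.
have : ~~ row_free M^T by rewrite /row_free mxrank_tr.
rewrite -kermx_eq0 => /rowV0Pn [y /sub_kermxP yM y0].
by apply/bigcupP; exists y => //; rewrite inE yM.
Qed.

Section Moment.
Variables (R : realFieldType) (F : finFieldType) (n b : nat) (S : {set 'rV[F]_n}).
Local Notation q := (#|F|%:R : R).

Lemma sum_load (M : 'M[F]_(n, b)) : \sum_y (load S M y)%:R = #|S|%:R :> R.
Proof. by rewrite -natr_sum (sum_fiber S (mulmx^~ M)). Qed.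

Lemma sum_load_sqr :
  (\sum_(M : 'M[F]_(n, b)) \sum_y load S M y ^ 2 =
   \sum_(x in S) \sum_(x' in S) #|[set M : 'M[F]_(n, b) | ((x - x') *m M)%R == 0%R]|)%N.
Proof.
transitivity (\sum_(M : 'M[F]_(n, b)) \sum_(x in S) \sum_(x' in S) (x *m M == x' *m M)%R)%N.
  apply: eq_bigr => M _; rewrite [RHS](partition_big (mulmx^~ M) xpredT) //=.
  apply: eq_bigr => y _; rewrite /load -mulnn -sum_nat_const.
  apply: eq_big => [x|x]; rewrite !inE // => /andP [_ /eqP xM].
  rewrite -sum1_card big_mkcond /= [RHS]big_mkcond /=; apply: eq_bigr => x' _.
  by rewrite inE xM eq_sym; case: (x' \in S) => //=; case: eqP.
rewrite exchange_big /=; apply: eq_bigr => x _.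
rewrite exchange_big /=; apply: eq_bigr => x' _.
rewrite -sum1_card [RHS]big_mkcond /=; apply: eq_bigr => M _.
by rewrite inE mulmxBl subr_eq0; case: eqP.
Qed.

(** Distinct points collide with probability [q^-b], as if they were independent, so only the
    diagonal pairs contribute to the variance. *)
Lemma load_second_moment :
  \sum_(M : 'M[F]_(n, b)) \sum_y ((load S M y)%:R - #|S|%:R / q ^+ b) ^+ 2 <=
  q ^+ (n * b) * #|S|%:R.
Proof.
have q0 : 0 < q by rewrite ltr0n; apply/card_gt0P; exists 0.
have qb0 : 0 < q ^+ b by rewrite exprn_gt0.
set s : R := #|S|%:R; set mu := s / q ^+ b.
have s0 : 0 <= s by rewrite ler0n.
pose T2 : R := \sum_(M : 'M[F]_(n, b)) \sum_y (load S M y)%:R ^+ 2.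
have hT2 : T2 <= s * q ^+ (n * b) + s ^+ 2 * (q ^+ (n * b) / q ^+ b).
  have -> : T2 = (\sum_(x in S) \sum_(x' in S) #|[set M : 'M[F]_(n, b) | ((x - x') *m M)%R ==
    0%R]|)%:R.
    rewrite -sum_load_sqr /T2 natr_sum; apply: eq_bigr => M _.
    by rewrite natr_sum; apply: eq_bigr => y _; rewrite natrX.
  have -> : s * q ^+ (n * b) + s ^+ 2 * (q ^+ (n * b) / q ^+ b) =
      \sum_(x in S) (q ^+ (n * b) + \sum_(x' in S) (q ^+ (n * b) / q ^+ b)).
    rewrite !sumr_const -mulr_natl -mulr_natl -/s; ring.
  rewrite natr_sum; apply: ler_sum => x xS.
  rewrite (bigD1 x) //= natrD; apply: lerD.
    rewrite subrr -natrX -card_mx ler_nat; exact: max_card.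
  rewrite natr_sum [leRHS](bigD1 x) //= -[leLHS]add0r; apply: lerD.
    by rewrite divr_ge0 // exprn_ge0 // ltW.
  apply: ler_sum => x' /andP [_ xx'].
  rewrite ler_pdivlMr // -natrX -natrM -natrX ler_nat card_annihilator //.
  by rewrite subr_eq0 eq_sym.
have e (M : 'M[F]_(n, b)) : \sum_y ((load S M y)%:R - mu) ^+ 2 =
    (\sum_y (load S M y)%:R ^+ 2) - mu * s.
  under eq_bigr => y _ do rewrite sqrrB.
  rewrite big_split sumrB /= sumrMnl -mulr_suml.
  rewrite sum_load -/s sumr_const card_mx mul1n.
  rewrite -[_ *+ (_ ^ _)]mulr_natr natrX /mu; field; exact: lt0r_neq0.
under eq_bigr => M _ do rewrite e.
rewrite sumrB -/T2 sumr_const card_mx -[X in _ - X]mulr_natr natrX /mu.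
rewrite lerBlDr; apply: le_trans hT2 _.
by rewrite le_eqVlt; apply/orP; left; apply/eqP; field; exact: lt0r_neq0.
Qed.
End Moment.

(** * Averaging, greedy covering and concentration of loads *)

Lemma exists_le_mean (R : realFieldType) (I : finType) (f : I -> R) v :
  (0 < #|I|)%N -> \sum_i f i <= #|I|%:R * v -> exists i, f i <= v.
Proof.
move=> I0 h; apply/existsP; apply: contraLR h; rewrite negb_exists => /forallP hf.
have [i0 _] := card_gt0P I0.
rewrite -ltNge mulr_natl -sumr_const; apply: ltr_sum => [|i _].
  by apply/hasP; exists i0; rewrite ?mem_index_enum.
by rewrite ltNge hf.
Qed.

(** Each [X] is found by averaging a single weighted sum of the uncovered part and the cost; two
    separate averages would not yield a common [X]. *)
Lemma greedy_cover (R : realFieldType) (Om T : finType) (cov : Om -> {set T}) (w : Om -> R)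
  (Dir : {set T}) (d1 b0 A : R) :
  (0 < #|Om|)%N -> d1 <= 1 -> 0 <= A ->
  (forall Q, Q \in Dir -> d1 * #|Om|%:R <= #|[set X | Q \in cov X]|%:R) ->
  \sum_X w X <= #|Om|%:R * b0 ->
  forall J (U : {set T}), U \subset Dir -> exists s : seq Om,
    A * #|U :\: \bigcup_(X <- s) cov X|%:R + \sum_(X <- s) w X <=
    A * (1 - d1) ^+ J * #|U|%:R + J%:R * b0.
Proof.
move=> Om0 d1le A0 hcov hw; elim=> [|J IH] U UD.
  by exists [::]; rewrite !big_nil setD0 expr0 mulr1 mul0r.
(* The price of an uncovered element is discounted by [1 - d1] for each of the [J] steps still to
   come. *)
pose c := A * (1 - d1) ^+ J.
have c0 : 0 <= c by rewrite mulr_ge0 // exprn_ge0 // subr_ge0.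
have hU : \sum_X #|U :\: cov X|%:R <= #|Om|%:R * ((1 - d1) * #|U|%:R) :> R.
  rewrite -natr_sum; have -> : (\sum_X #|U :\: cov X| = \sum_(Q in U) #|[set X | Q \notin cov
    X]|)%N.
    under eq_bigr do rewrite -sum1_card big_mkcond /=.
    rewrite exchange_big /= [RHS]big_mkcond /=; apply: eq_bigr => Q _.
    case: ifP => QU; last by rewrite big1 // => X _; rewrite inE QU andbF.
    by rewrite -sum1_card [RHS]big_mkcond /=; apply: eq_bigr => X _; rewrite !inE QU andbT.
  have -> : #|Om|%:R * ((1 - d1) * #|U|%:R) = \sum_(Q in U) #|Om|%:R * (1 - d1).
    by rewrite sumr_const -[RHS]mulr_natr mulrA.
  rewrite natr_sum; apply: ler_sum => Q QU.
  have := hcov Q (subsetP UD Q QU).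
  have -> : [set X | Q \notin cov X] = ~: [set X | Q \in cov X] by apply/setP => X; rewrite !inE.
  by rewrite [#|~: _|]cardsCs setCK natrB ?max_card //; lra.
have [X hX] : exists X, c * #|U :\: cov X|%:R + w X <= c * ((1 - d1) * #|U|%:R) + b0.
  apply: exists_le_mean => //; rewrite big_split -mulr_sumr /= mulrDr mulrCA.
  by apply: lerD => //; rewrite ler_wpM2l.
have [|s hs] := IH (U :\: cov X); first by apply: subset_trans UD; apply: subsetDl.
exists (X :: s); rewrite !big_cons -setDDl.
have e : A * (1 - d1) ^+ J.+1 * #|U|%:R = c * ((1 - d1) * #|U|%:R) by rewrite exprSr /c; ring.
rewrite e -natr1 mulrDl mul1r; rewrite -/c in hs; lra.
Qed.

Lemma load_chebyshev (R : realFieldType) (F : finFieldType) n b (S : {set 'rV[F]_n})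
  (p : 'M[F]_(n, b) -> 'rV[F]_b -> bool) (h : R) : 0 <= h ->
  (forall M y, p M y -> h <= `|(load S M y)%:R - #|S|%:R / #|F|%:R ^+ b|) ->
  (\sum_M #|[set y | p M y]|)%:R * h ^+ 2 <= #|F|%:R ^+ (n * b) * #|S|%:R.
Proof.
move=> h0 hp; apply: le_trans (load_second_moment R b S).
rewrite natr_sum mulr_suml; apply: ler_sum => M _.
rewrite -sum1_card natr_sum mulr_suml big_mkcond /=; apply: ler_sum => y _.
rewrite inE; case: ifP => [/hp hy|_]; last exact: sqr_ge0.
by rewrite mul1r -[leRHS]real_normK ?num_real // lerXn2r ?nnegrE.
Qed.

(** If [L] and [R] are the invertible factors in the rank factorization of [Q], then [diag(L, 1) R]
    is invertible with top block [Q]. *)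
Lemma unitmx_completion (F : fieldType) m1 m2 (Q : 'M[F]_(m1, m1 + m2)) : row_free Q ->
  exists2 C : 'M[F]_(m1 + m2), C \in unitmx & usubmx C = Q.
Proof.
move=> /eqP rQ.
exists (block_mx (col_ebase Q) 0 0 1%:M *m row_ebase Q).
  rewrite unitmx_mul row_ebase_unit andbT unitmxE det_lblock det1 mulr1 -unitmxE.
  exact: col_ebase_unit.
rewrite -mul_usub_mx; rewrite -[RHS]mulmx_ebase rQ; congr (_ *m _).
rewrite /block_mx col_mxKu; apply/matrixP => i j; rewrite !mxE.
case: splitP => k jk.
  rewrite (bigD1 k) //= !mxE jk eqxx ltn_ord mulr1 big1 ?addr0 // => l lk.
  by rewrite !mxE jk (inj_eq val_inj) (negPf lk) mulr0.
rewrite !mxE big1 // => l _; rewrite !mxE jk.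
by rewrite (ltn_eqF (leq_trans (ltn_ord l) (leq_addr _ _))) mulr0.
Qed.

Lemma load_row_mx (F : finFieldType) n b t (S : {set 'rV[F]_n}) (N : 'M[F]_(n, b)) (M : 'M[F]_(n,
  t)) z y :
  load S (row_mx N M) (row_mx z y) = load [set x in S | x *m M == y] N z.
Proof.
rewrite /load; apply: eq_card => x; rewrite !inE mul_mx_row -andbA; congr (_ && _).
by apply/eqP/andP => [/eq_row_mx [-> ->]|[/eqP -> /eqP ->]].
Qed.

Lemma load_mul_unit (F : finFieldType) n m (S : {set 'rV[F]_n}) (X : 'M[F]_(n, m)) (C : 'M[F]_m) Y :
  C \in unitmx -> load S (X *m C) (Y *m C) = load S X Y.
Proof.
move=> uC; apply: eq_card => x; rewrite !inE mulmxA.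
by rewrite (inj_eq (can_inj (mulmxK uC))).
Qed.

(** Chebyshev bounds the missing proportion by [x / (x - c)^2], with [x] the average load. This
    decreases for [x > c], so its value at the lower bound [a] suffices. *)
Lemma few_missing (R : realFieldType) (F : finFieldType) n b (S : {set 'rV[F]_n}) (a c eta : R) :
  0 <= c -> c < a -> a < #|S|%:R / #|F|%:R ^+ b -> a <= eta * (a - c) ^+ 2 ->
  (\sum_(N : 'M[F]_(n, b)) #|[set z | ((load S N z)%:R < c)%R]|)%:R <=
    eta * #|F|%:R ^+ b * #|F|%:R ^+ (n * b) :> R.
Proof.
set x := _ / _ => c0 ca ax ha.
have q0 : 0 < #|F|%:R ^+ b :> R by rewrite exprn_gt0 // ltr0n; apply/card_gt0P; exists 0.
have Sx : #|S|%:R = x * #|F|%:R ^+ b by rewrite /x divfK // lt0r_neq0.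
set m : R := _%:R.
have hm : m * (x - c) ^+ 2 <= #|F|%:R ^+ (n * b) * #|S|%:R.
  apply: (load_chebyshev (p := fun N z => (load S N z)%:R < c)) => [|N y hN].
    by rewrite subr_ge0 ltW // (lt_trans ca).
  by rewrite -/x ler0_norm; lra.
have h2 : 0 < (x - c) ^+ 2 by rewrite exprn_gt0 // subr_gt0 (lt_trans ca).
rewrite -(ler_pM2r h2); apply: le_trans hm _; rewrite Sx.
set QQ := _ ^+ (n * b); have QQ0 : 0 <= QQ by rewrite exprn_ge0.
have key : x <= eta * (x - c) ^+ 2.
  have e0 : 0 <= (a - c) ^+ 2 by apply: sqr_ge0.
  have ac0 : 0 < (a - c) ^+ 2 by rewrite exprn_gt0 // subr_gt0.
  have eta0 : a / (a - c) ^+ 2 <= eta by rewrite ler_pdivrMr.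
  apply: le_trans (ler_wpM2r (ltW h2) eta0).
  rewrite mulrAC ler_pdivlMr //.
  have : c ^+ 2 * (x - a) <= a * x * (x - a).
    by rewrite ler_wpM2r ?subr_ge0 ?ltW //; nra.
  by rewrite !expr2; nra.
set Q2 := #|F|%:R ^+ b in q0 *.
have -> : QQ * (x * Q2) = (Q2 * QQ) * x by ring.
have -> : eta * Q2 * QQ * (x - c) ^+ 2 = (Q2 * QQ) * (eta * (x - c) ^+ 2) by ring.
by rewrite ler_wpM2l // mulr_ge0 // ltW.
Qed.

Lemma card_row_full_ge (F : finFieldType) n t : (20 <= #|F|)%N -> (t + 4 <= n)%N ->
  (99 * #|F| ^ (n * t) <= 100 * #|[set M : 'M[F]_(n, t) | row_full M]|)%N.
Proof.
move=> q20 tn; have := card_not_row_full F n t.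
have -> : [set M : 'M[F]_(n, t) | ~~ row_full M] = ~: [set M | row_full M].
  by apply/setP => M; rewrite !inE.
have := cardsC [set M : 'M[F]_(n, t) | row_full M]; rewrite card_mx.
set x := #|[set M | _]|; set y := #|~: _|; set Q := (_ ^ (n * t))%N => xy.
rewrite -(subnKC tn) -addnA expnD mulnCA leq_pmul2l ?expn_gt0; last by rewrite (leq_trans _ q20).
move=> h; suff : (100 * y <= Q)%N by lia.
apply: leq_trans h; rewrite mulnC leq_mul2l; apply/orP; right.
apply: (@leq_trans (#|F| ^ 4)); last by rewrite leq_exp2l ?leq_addr // (leq_trans _ q20).
by apply: leq_trans (_ : 20 ^ 4 <= _)%N => //; rewrite leq_exp2r.
Qed.

Lemma card_row_free_ge (F : finFieldType) m : (20 <= #|F|)%N -> (3 <= m)%N ->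
  (95 * #|F| ^ (2 * m) <= 100 * #|[set Q : 'M[F]_(2, m) | row_free Q]|)%N.
Proof.
move=> q20 m3; have := card_not_row_full F m 2.
have -> : #|[set M : 'M[F]_(m, 2) | ~~ row_full M]| = #|~: [set Q : 'M[F]_(2, m) | row_free Q]|.
  rewrite -(card_imset _ (@trmx_inj F 2 m)); apply: eq_card => M.
  apply/idP/imsetP => [|[Q + ->]]; rewrite !inE.
    by move=> h; exists M^T; rewrite ?trmxK // !inE /row_free mxrank_tr.
  by rewrite /row_full mxrank_tr.
have := cardsC [set Q : 'M[F]_(2, m) | row_free Q]; rewrite card_mx [(m * 2)%N]mulnC.
set x := #|[set M | _]|; set y := #|~: _|; set Q := (_ ^ (2 * m))%N => xy.
have m2 : (2 <= m)%N by apply: leq_trans m3.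
rewrite -(subnKC m2) expnD mulnCA leq_pmul2l ?expn_gt0; last by rewrite (leq_trans _ q20).
move=> h; suff : (20 * y <= Q)%N by lia.
apply: leq_trans h; rewrite mulnC leq_mul2l; apply/orP; right.
apply: (leq_trans q20); rewrite -{1}[#|F|]expn1 leq_exp2l ?subn_gt0 //.
by rewrite (leq_trans _ q20).
Qed.

(* [covered X] are the 2-plane directions of which [heavy X] nearly contains a translate;
   [rich] is the event that the direction of the first two coordinates is one of them. *)
Section Core.
Variables (R : realFieldType) (F : finFieldType) (n t : nat) (S : {set 'rV[F]_n}).
Local Notation q := (#|F|%:R : R).
Variable c : R.

Definition heavy (X : 'M[F]_(n, 2 + t)) : {set 'rV[F]_(2 + t)} :=
  [set Y | c <= (load S X Y)%:R].

Definition covered (X : 'M[F]_(n, 2 + t)) : {set 'M[F]_(2, 2 + t)} :=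
  [set Q | [exists a, (10 * n - 1) * #|F| ^ 2 <=
     10 * n * #|[set z : 'rV[F]_2 | (z *m Q + a)%R \in heavy X]|]%N].

Definition rich : {set 'M[F]_(n, 2 + t)} :=
  [set X | [exists y : 'rV[F]_t, (10 * n - 1) * #|F| ^ 2 <=
     10 * n * #|[set z : 'rV[F]_2 | row_mx z y \in heavy X]|]%N].

(** Right multiplication by an invertible [C] with top rows [Q] preserves loads and carries the
    planes [[z | y]] to planes of direction [Q], so it maps [rich] injectively into the matrices
    covering [Q]. *)
Lemma covered_rich (Q : 'M[F]_(2, 2 + t)) : row_free Q ->
  (#|rich| <= #|[set X | Q \in covered X]|)%N.
Proof.
move=> /unitmx_completion [C uC CQ].
rewrite -(card_imset _ (can_inj (mulmxK uC))); apply/subset_leq_card/subsetP => X' /imsetP [X + ->].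
rewrite !inE => /existsP [y hy]; apply/existsP; exists (y *m dsubmx C).
apply: leq_trans hy _; rewrite leq_mul2l; apply/orP; right.
apply/subset_leq_card/subsetP => z; rewrite !inE -CQ -mul_row_col vsubmxK.
by rewrite load_mul_unit.
Qed.

Lemma card_rich (Bad : {set 'M[F]_(n, t)}) :
  (\sum_(M in Bad) #|[set N | row_mx N M \in rich]| <= #|rich|)%N.
Proof.
rewrite -(sum_fiber rich (@rsubmx _ n 2 t)) big_mkcond /=; apply: leq_sum => M _.
case: ifP => // _.
have inj : injective (fun N : 'M[F]_(n, 2) => row_mx N M) by move=> N N' /eq_row_mx [].
rewrite -(card_imset _ inj); apply/subset_leq_card/subsetP => X /imsetP [N + ->].
by rewrite inE => hN; rewrite inE row_mxKr eqxx andbT.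
Qed.

Hypotheses (n20 : (20 <= n)%N) (nq : (n <= #|F|)%N).

(** Inside the fibre the mean missing proportion is at most [eta <= 1/(100 n)]; by Markov at most a
    tenth of the [N] miss more than [1/(10 n)] of the plane. *)
Lemma rich_fibre (M : 'M[F]_(n, t)) (y : 'rV[F]_t) (a eta : R) :
  0 <= c -> c < a -> a < (load S M y)%:R / q ^+ 2 -> a <= eta * (a - c) ^+ 2 ->
  100%:R * n%:R * eta <= 1 ->
  9%:R / 10%:R * q ^+ (n * 2) <= #|[set N | row_mx N M \in rich]|%:R.
Proof.
move=> c0 ca ax ha he.
have q0 : 0 < q by rewrite ltr0n; apply: leq_trans nq; apply: leq_trans n20.
have n0 : 0 < n%:R :> R by rewrite ltr0n; apply: leq_trans n20.
have hmiss := few_missing c0 ca ax ha.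
set T := [set x in S | x *m M == y] in hmiss *.
pose miss (N : 'M[F]_(n, 2)) := #|[set z | ((load T N z)%:R < c)%R]|.
have hits N : #|[set z : 'rV[F]_2 | row_mx z y \in heavy (row_mx N M)]| = (#|F| ^ 2 - miss N)%N.
  have -> : [set z : 'rV[F]_2 | row_mx z y \in heavy (row_mx N M)] = ~: [set z | ((load T N z)%:R
    < c)%R].
    by apply/setP => z; rewrite !inE load_row_mx -leNgt.
  by rewrite cardsCs setCK card_mx mul1n.
set good := [set N | _].
have hbad N : N \notin good -> (#|F| ^ 2 <= 10 * n * miss N)%N.
  rewrite !inE negb_exists => /forallP /(_ y); rewrite hits -ltnNge.
  by move: n20; clear; move: (#|F| ^ 2)%N (miss N) => x m; nia.
have hsum : (#|~: good| * #|F| ^ 2 <= 10 * n * \sum_N miss N)%N.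
  rewrite -sum_nat_const big_distrr big_mkcond /=; apply: leq_sum => N _.
  by rewrite inE; case: ifP => // /hbad.
have := cardsC good; rewrite card_mx => hc.
have {}hsum : #|~: good|%:R * q ^+ 2 <= 10%:R * n%:R * (eta * q ^+ 2 * q ^+ (n * 2)) :> R.
  apply: le_trans (ler_wpM2l _ hmiss); last by rewrite mulr_ge0 ?ler0n.
  by rewrite -natrX -!natrM ler_nat.
have q2 : 0 < q ^+ 2 by rewrite exprn_gt0.
have hb : 10%:R * #|~: good|%:R <= q ^+ (n * 2) :> R.
  rewrite -(ler_pM2r q2).
  have h1 : 10%:R * #|~: good|%:R * q ^+ 2 <= 100%:R * n%:R * eta * (q ^+ (n * 2) * q ^+ 2).
    have -> : 100%:R * n%:R * eta * (q ^+ (n * 2) * q ^+ 2) = 10%:R * (10%:R * n%:R * (eta * q ^+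
      2 * q ^+ (n * 2))) by ring.
    by rewrite -mulrA ler_wpM2l ?ler0n.
  apply: le_trans h1 _; rewrite ler_piMl // mulr_ge0 // ?ltW //; exact: exprn_gt0.
have : (#|good| + #|~: good|)%:R = q ^+ (n * 2) :> R by rewrite hc natrX.
by rewrite natrD; lra.
Qed.

Hypotheses (t1 : (1 <= t)%N) (tn : (t + 4 <= n)%N).
Variable b0 delta : R.
Hypotheses (d0 : 0 < delta) (d10 : delta < 1 / 10%:R).
Hypothesis hrich : 9%:R / 10%:R * q ^+ (n * 2) * (delta * #|[set M : 'M[F]_(n, t) | row_full
  M]|%:R) <= #|rich|%:R.
Hypothesis hheavy : \sum_X #|heavy X|%:R <= q ^+ (n * (2 + t)) * b0.
Hypothesis hb0 : 200%:R * b0 <= delta * q ^+ (2 + t).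

Variable J : nat.
Hypotheses (J1 : J%:R * delta <= 245%:R / 100%:R)
  (J2 : (1 - 89%:R / 100%:R * delta) ^+ J <= 1 / 4%:R).

Lemma amplified_contradiction : False.
Proof.
have q0 : 0 < q by rewrite ltr0n; apply: leq_trans nq; apply: leq_trans n20.
have q20 : (20 <= #|F|)%N by apply: leq_trans nq.
pose Dir := [set Q : 'M[F]_(2, 2 + t) | row_free Q].
have hfull := card_row_full_ge q20 tn.
have hDir := @card_row_free_ge F (2 + t) q20 ltac:(lia).
rewrite -/Dir in hDir.
set V := q ^+ (2 + t).
have V0 : 0 < V by rewrite exprn_gt0.
have D0 : 0 < #|Dir|%:R :> R.
  by rewrite ltr0n lt0n; apply: contraTneq hDir => ->; rewrite muln0 -ltnNge muln_gt0 expn_gt0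
    (leq_trans _ q20).
(* With this weight, leaving half of [Dir] uncovered costs [V / 27], exactly what the Kakeya bound
   costs when half is covered. *)
pose A : R := 2%:R / 27%:R * V / #|Dir|%:R.
have A0 : 0 <= A by rewrite /A divr_ge0 ?ltW // mulr_gt0 // divr_gt0 ?ltr0n.
have Om : #|{: 'M[F]_(n, 2 + t)}|%:R = q ^+ (n * (2 + t)) :> R by rewrite card_mx natrX.
(* The factor [9/10] of [hrich] times the proportion [99/100] of surjective maps is at least
   [89/100]. *)
have hd Q : Q \in Dir -> 89%:R / 100%:R * delta * #|{: 'M[F]_(n, 2 + t)}|%:R <=
    #|[set X | Q \in covered X]|%:R.
  rewrite inE => /covered_rich hQ.
  apply: le_trans (_ : #|rich|%:R <= _); last by rewrite ler_nat.
  apply: le_trans hrich; rewrite Om mulnDr exprD.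
  have hF : 99%:R * q ^+ (n * t) <= 100%:R * #|[set M : 'M[F]_(n, t) | row_full M]|%:R.
    by rewrite -natrX -!natrM ler_nat.
  set x := q ^+ (n * 2); set z := q ^+ (n * t) in hF *; set f := #|[set M | _]|%:R in hF *.
  have xd : 0 <= x * delta by rewrite mulr_ge0 ?ltW // exprn_gt0.
  have z0 : 0 <= z by rewrite exprn_ge0 // ltW.
  have -> : 89%:R / 100%:R * delta * (x * z) = (x * delta) * (89%:R / 100%:R * z) by ring.
  have -> : 9%:R / 10%:R * x * (delta * f) = (x * delta) * (9%:R / 10%:R * f) by ring.
  by rewrite ler_wpM2l //; lra.
have d1le : 89%:R / 100%:R * delta <= 1 by move: d10; lra.
have Om0 : (0 < #|{: 'M[F]_(n, 2 + t)}|)%N by apply/card_gt0P; exists 0.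
have hw : \sum_(X : 'M[F]_(n, 2 + t)) #|heavy X|%:R <= #|{: 'M[F]_(n, 2 + t)}|%:R * b0.
  by rewrite Om.
have [s hs] := greedy_cover Om0 d1le A0 hd hw J (subxx Dir).
set U := \bigcup_(X <- s) covered X in hs.
pose Bs := \bigcup_(X <- s) heavy X.
have hBs : #|Bs|%:R <= \sum_(X <- s) #|heavy X|%:R :> R.
  rewrite -natr_sum ler_nat /Bs; elim: (s) => [|X s' IH]; first by rewrite !big_nil cards0.
  rewrite !big_cons; apply: leq_trans (leq_card_setU _ _) _; by rewrite leq_add2l.
have sB X : X \in s -> heavy X \subset Bs.
  by move=> Xs; rewrite /Bs (big_rem X) //= subsetUl.
have hkak : (#|Dir| <= 2 * #|Dir :&: U|)%N -> V <= 27%:R * #|Bs|%:R.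
  move=> hDU; rewrite /V -natrX -natrM ler_nat.
  apply: (@kakeya_planes_density F n (2 + t) Bs (Dir :&: U)) => //.
  - by apply: leq_trans n20.
  - by move: tn; clear; lia.
  (* Half of 95% of all pairs exceeds the [2/5] that the density bound requires. *)
  - have : (0 < #|F| ^ (2 * (2 + t)))%N by rewrite expn_gt0 (leq_trans _ q20).
    move: hDir hDU; set x1 := (_ ^ _)%N; set x2 := #|Dir|; set x3 := #|Dir :&: U|; move: x1 x2
      x3; clear => x1 x2 x3; lia.
  move=> Q; rewrite inE => /andP [_].
  have : {subset s <= s} by [].
  rewrite /U; elim: {1 3}(s) => [|X s' IH] hsub; first by rewrite big_nil inE.
  rewrite big_cons inE => /orP [|h]; last by apply: IH h => x xs; apply: hsub; rewrite inE xs orbT.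
  rewrite inE => /existsP [a ha]; exists a; apply: leq_trans ha _; rewrite leq_mul2l; apply/orP;
    right.
  apply/subset_leq_card/subsetP => z; rewrite !inE => hz.
  by apply: (subsetP (sB X (hsub _ (mem_head _ _)))); rewrite inE.
have hsplit : (#|Dir :&: U| + #|Dir :\: U| = #|Dir|)%N := cardsID U Dir.
have AD : A * #|Dir|%:R = 2%:R / 27%:R * V by rewrite /A divfK // lt0r_neq0.
have low : V / 27%:R <= A * #|Dir :\: U|%:R + \sum_(X <- s) #|heavy X|%:R.
  have [hc|hc] := leqP #|Dir| (2 * #|Dir :&: U|).
    have := hkak hc; have : 0 <= A * #|Dir :\: U|%:R by rewrite mulr_ge0.
    by move: hBs; lra.
  have hU : #|Dir|%:R <= 2%:R * #|Dir :\: U|%:R :> R.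
    by rewrite -natrM ler_nat; move: hc hsplit; clear; lia.
  have := ler_wpM2l A0 hU; rewrite AD.
  have : 0 <= #|Bs|%:R :> R by [].
  by move: hBs; lra.
(* The total after [J] steps is at most [V (1/54 + 0.01225)], which is below [V / 27]. *)
have := le_trans low hs.
rewrite [A * _ * _]mulrAC AD.
have h1 : 2%:R / 27%:R * V * (1 - 89%:R / 100%:R * delta) ^+ J <= 2%:R / 27%:R * V * (1 / 4%:R).
  by apply: ler_wpM2l => //; apply: mulr_ge0; [lra | exact: ltW].
have h2 : 200%:R * (J%:R * b0) <= 245%:R / 100%:R * V.
  rewrite mulrCA; apply: le_trans (ler_wpM2l (ler0n _ J) hb0) _.
  by rewrite mulrA ler_wpM2r // ltW.
by move: V0 h1 h2; lra.
Qed.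
End Core.

(** * The number of greedy steps and the final assembly *)

(** Let [d = 0.89 delta] and let [k] be just above [1/d]. Bernoulli gives [(1 + d)^k >= 2], so
    [(1 - d)^k <= 1/2], and [J = 2 k] works: [J delta <= 2 (1 + d) / 0.89 < 2.45] as [d < 0.089]. *)
Lemma exists_amplification (R : archiRealFieldType) (delta : R) :
  0 < delta -> delta < 1 / 10%:R ->
  exists J, J%:R * delta <= 245%:R / 100%:R /\ (1 - 89%:R / 100%:R * delta) ^+ J <= 1 / 4%:R.
Proof.
move=> d0 d10; pose d := 89%:R / 100%:R * delta.
have dd : 0 < d by rewrite /d; lra.
have d1 : d < 1 by rewrite /d; lra.
have bern k : 1 + k%:R * d <= (1 + d) ^+ k.
  elim: k => [|k IH]; first by rewrite mul0r addr0 expr0.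
  rewrite exprS; apply: le_trans (ler_wpM2l _ IH); last by lra.
  have : 0 <= k%:R * d * d by apply: mulr_ge0 (ltW dd); apply: mulr_ge0 (ltW dd); exact: ler0n.
  by rewrite -natr1; lra.
pose k := (Num.truncn (1 / d)).+1.
have k1 : 1 <= k%:R * d.
  by rewrite -ler_pdivrMr // ltW // truncnS_gt.
have k2 : k%:R <= 1 / d + 1.
  rewrite /k -natr1 lerD2r truncn_le //; by rewrite divr_ge0 // ltW.
exists (2 * k)%N; split.
  have h : k%:R * d <= 1 + d.
    by apply: le_trans (ler_wpM2r (ltW dd) k2) _; rewrite mulrDl !mul1r mulVf ?lt0r_neq0.
  by move: h; rewrite natrM /d; lra.
rewrite mulnC exprM; set x := (1 - _) ^+ k.
have x0 : 0 <= x by rewrite exprn_ge0 // subr_ge0 ltW.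
have hx : x * 2%:R <= 1.
  apply: le_trans (_ : x * (1 + d) ^+ k <= _).
    by rewrite ler_wpM2l //; apply: le_trans (bern k); lra.
  rewrite -exprMn; apply: exprn_ile1; rewrite -/d; nra.
by rewrite expr2; nra.
Qed.

Unset Implicit Arguments.

Theorem mainTheorem5 (R : realType) (F : finFieldType) (q n r : nat)
  (S : {set 'rV[F]_n}) (tau delta : R) :
  #|F| = q ->
  (20 <= n)%N ->
  1 < tau ->
  0 < delta -> delta < 1 / 10 ->
  (n%:R * (1 + tau)) / ((tau - Num.sqrt tau) ^+ 2 * delta ^+ 2) <= q%:R ->
  (n <= q)%N ->
  (4 <= r)%N -> (r <= n - 1)%N ->
  (q ^ r < #|S| <= q ^ r.+1)%N ->
  (1 - delta) * #|[set M : 'M[F]_(n, r - 3) | row_full M]|%:R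
    <= #|[set M : 'M[F]_(n, r - 3) | row_full M &
           close_to_uniform R S M (tau / (q%:R ^+ (r - 3)))]|%:R.
Proof.
move=> Fq n20 tau1 d0 d10 hq nq r4 rn /andP [Slo _].
set t := (r - 3)%N; have rE : r = (t + 3)%N by rewrite /t; lia.
have t1 : (1 <= t)%N by rewrite /t; lia.
have tn : (t + 4 <= n)%N by rewrite /t; lia.
pose Q : R := q%:R.
have Q0 : 0 < Q by rewrite ltr0n; lia.
have n0 : 0 < n%:R :> R by rewrite ltr0n; lia.
pose th := Num.sqrt tau; pose s : R := #|S|%:R.
have th2 : th ^+ 2 = tau by rewrite sqr_sqrtr //; lra.
have th1 : 1 < th by rewrite -[ltLHS]sqrtr1 ltr_sqrt; lra.
have tht : th < tau by rewrite -th2 expr2; nra.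
have s0 : 0 < s by rewrite ltr0n; apply: leq_ltn_trans Slo.
(* The mean load in dimension [2 + t = r - 1]; it exceeds [q] because [#|S| > q^r]. *)
pose avg := s / Q ^+ (2 + t).
have avgQ : Q < avg.
  rewrite ltr_pdivlMr ?exprn_gt0 // -exprS -natrX ltr_nat.
  by rewrite (_ : (2 + t).+1 = r) // rE; lia.
have avg0 : 0 < avg by apply: lt_trans avgQ.
have hq' : n%:R * (1 + tau) <= Q * ((tau - th) ^+ 2 * delta ^+ 2).
  by rewrite -ler_pdivrMr // mulr_gt0 // exprn_gt0 // subr_gt0.
(* The threshold lies [th avg] above the mean load, and more than [(tau - th) avg] below the mean
   load inside an overfull fibre. *)
pose c := (1 + th) * avg.
pose Full := [set M : 'M[F]_(n, t) | row_full M].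
pose Bad := [set M in Full | ~~ close_to_uniform R S M (tau / Q ^+ t)].
have hcard : (#|[set M : 'M[F]_(n, t) | row_full M & close_to_uniform R S M (tau / Q ^+ t)]| +
  #|Bad| = #|Full|)%N.
  rewrite -(cardsID [set M | close_to_uniform R S M (tau / Q ^+ t)] Full); congr (_ + _)%N.
    by apply: eq_card => M; rewrite !inE.
  by apply: eq_card => M; rewrite !inE andbC.
have hn : n%:R <= Q * tau * delta ^+ 2.
  have e1 : (tau - th) ^+ 2 <= tau ^+ 2 by rewrite !expr2; nra.
  have e2 : n%:R * tau <= Q * (tau ^+ 2 * delta ^+ 2).
    apply: le_trans (_ : n%:R * (1 + tau) <= _); first by rewrite ler_wpM2l ?ltW //; lra.
    by apply: le_trans hq' _; apply: (ler_wpM2l (ltW Q0)); apply: ler_wpM2r => //; exact: sqr_ge0.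
  have tau0 : 0 < tau by lra.
  rewrite -(ler_pM2r tau0); apply: le_trans e2 _.
  by rewrite le_eqVlt; apply/orP; left; apply/eqP; ring.
have d2 : 100%:R * delta ^+ 2 <= 1 by rewrite expr2; nra.
(* [eta] serves twice: as the missing proportion inside an overfull fibre and as the mean density of
   [heavy]. *)
pose eta := delta ^+ 2 / n%:R.
have load_large M : M \in Bad -> exists y, (1 + tau) * s < (load S M y)%:R * Q ^+ t.
  rewrite !inE => /andP [_]; rewrite negb_forall => /existsP [y]; rewrite -ltNge => hy.
  exists y; move: hy; rewrite card_mx mul1n Fq natrX -/Q /prob_img -/(load S M y) -/s.
  have Qt : 0 < Q ^+ t by rewrite exprn_gt0.
  set p := _ / s => hy.
  have p0 : 0 <= p by rewrite divr_ge0 // ltW.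
  have hp : (1 + tau) / Q ^+ t < p.
    have i0 : 0 < (Q ^+ t)^-1 by rewrite invr_gt0.
    move: hy; rewrite mulrDl; case: (lerP 0 (p - 1 / Q ^+ t)) => h.
      by rewrite ger0_norm //; lra.
    (* Here the probability falls short of [Q^-t] by at most [Q^-t], which is within the tolerance
       since [1 < tau]. *)
    by rewrite ltr0_norm //; move: i0 tau1 p0; rewrite !mul1r; move: (_^-1) => z; nra.
  by move: hp; rewrite ltr_pdivrMr // mulrAC ltr_pdivlMr.
have fibre M : M \in Bad ->
    9%:R / 10%:R * Q ^+ (n * 2) <= #|[set N | row_mx N M \in rich t S c]|%:R.
  move=> /load_large [y hy]; rewrite /Q -Fq.
  have hc0 : 0 <= c by rewrite mulr_ge0 ?ltW //; lra.
  apply: (@rich_fibre R F n t S c n20 _ M y ((1 + tau) * avg) eta) => //.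
  - by rewrite Fq.
  - by rewrite ltr_pM2r //; lra.
  - rewrite Fq -/Q /avg exprD mulrA ltr_pdivrMr; last by rewrite mulr_gt0 ?exprn_gt0.
    by rewrite mulrA divfK // lt0r_neq0 // exprn_gt0.
  (* This reduces to [n (1 + tau) <= avg (tau - th)^2 delta^2], the hypothesis on [q] with the
     larger [avg] in place of [q]. *)
  - have -> : (1 + tau) * avg - c = (tau - th) * avg by rewrite /c; ring.
    rewrite /eta exprMn mulrAC ler_pdivlMr //.
    have -> : delta ^+ 2 * ((tau - th) ^+ 2 * avg ^+ 2) = (avg * ((tau - th) ^+ 2 * delta ^+ 2))
      * avg by ring.
    have -> : (1 + tau) * avg * n%:R = n%:R * (1 + tau) * avg by ring.
    rewrite ler_pM2r //; apply: le_trans hq' _.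
    by apply: ler_wpM2r; [rewrite mulr_ge0 ?sqr_ge0 | exact: ltW].
  rewrite (_ : 100%:R * n%:R * eta = 100%:R * delta ^+ 2) // /eta; field; exact: lt0r_neq0.
rewrite leNgt; apply/negP => hlt.
have hBad : delta * #|Full|%:R < #|Bad|%:R.
  move: hlt; rewrite -/Q -/Full -hcard natrD; lra.
have [J [J1 J2]] := @exists_amplification R delta d0 d10.
apply: (@amplified_contradiction R F n t S c n20 _ t1 tn (Q ^+ (2 + t) * eta) delta d0 d10 _ _ _
  J J1 J2).
- by rewrite Fq.
- rewrite Fq -/Q.
  apply: le_trans (_ : 9%:R / 10%:R * Q ^+ (n * 2) * #|Bad|%:R <= _).
    apply: ler_wpM2l; last exact: ltW.
    by apply: mulr_ge0; [lra | rewrite exprn_ge0 // ltW].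
  apply: le_trans (_ : (\sum_(M in Bad) #|[set N | row_mx N M \in rich t S c]|)%:R <= _); last
    first.
    by rewrite ler_nat card_rich.
  by rewrite natr_sum mulr_natr -sumr_const; apply: ler_sum.
(* A heavy point deviates by at least [th avg], so the mean size of [heavy] is at most
   [Q^(2+t) / (tau avg)]; [hn] and [Q < avg] bound this by [Q^(2+t) eta]. *)
- have := @load_chebyshev R F n (2 + t) S (fun M y => c <= (load S M y)%:R) (th * avg).
  rewrite Fq -/Q -/s -/avg => hch.
  have ta : 0 < (th * avg) ^+ 2 by rewrite exprn_gt0 // mulr_gt0 //; lra.
  rewrite -natr_sum -(ler_pM2r ta); apply: le_trans (hch _ _) _.
  + by rewrite mulr_ge0 // ltW //; lra.
  + move=> M y hy; apply: le_trans (ler_norm _).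
    by move: hy; rewrite /c mulrDl mul1r; lra.
  rewrite exprMn th2 -[leRHS]mulrA; apply: ler_wpM2l; first by rewrite exprn_ge0 // ltW.
  have -> : s = avg * Q ^+ (2 + t) by rewrite divfK // lt0r_neq0 // exprn_gt0.
  have -> : Q ^+ (2 + t) * eta * (tau * avg ^+ 2) = (avg * tau * eta) * (avg * Q ^+ (2 + t)) by
    ring.
  rewrite ler_peMl; [by [] | by rewrite mulr_ge0 ?exprn_ge0 // ltW |].
  rewrite /eta mulrA ler_pdivlMr // mul1r; apply: le_trans hn _.
  apply: ler_wpM2r; first exact: sqr_ge0.
  by apply: ler_wpM2r; [lra | exact: ltW].
(* What remains is [200 delta^2 / n <= delta], from [n >= 20] and [delta < 1/10]. *)
rewrite Fq -/Q mulrCA mulrC; apply: ler_wpM2r; first by rewrite exprn_ge0 // ltW.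
rewrite /eta mulrA ler_pdivrMr //.
have n20R : 20%:R <= n%:R :> R by rewrite ler_nat.
rewrite expr2; nra.
Qed.
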